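(* Let $X$ be a Polish space, let $2\le k\le N$ be integers, and let $\Phi\in C_b(X^k)$ be symmetric. Then for every $\rho\in\mathcal P(X)$ the functional $$C_{N,k}(\rho):=\inf\Big\{\int_{X^N}c_\Phi\,d\gamma:\ \gamma\in\mathcal P_{\mathrm{sym}}(X^N),\ M_1\gamma=\rho\Big\},\qquad c_\Phi(x_1,\dots,x_N):=\frac1{\binom Nk}\sum_{1\le i_1<\dots<i_k\le N}\Phi(x_{i_1},\dots,x_{i_k}),$$ satisfies $$C_{N,k}(\rho)=\inf\Big\{\int_{\mathcal P_{\frac1N}(X)}\Big(\int_{X^k}\Phi\,dF_{N,k}(\lambda)\Big)d\alpha(\lambda):\ \alpha\in\mathcal P(\mathcal P_{\frac1N}(X)),\ \int_{\mathcal P_{\frac1N}(X)}\lambda\,d\alpha(\lambda)=\rho\Big\}.$$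
   Context: $\mathcal P(Y)$ denotes the Borel probability measures on a Polish space $Y$, with the narrow topology (convergence tested against bounded continuous functions); $C_b$ denotes bounded continuous functions. $\Phi$ symmetric means $\Phi(x_{\sigma(1)},\dots,x_{\sigma(k)})=\Phi(x_1,\dots,x_k)$ for all permutations $\sigma$. For $\gamma\in\mathcal P(X^N)$, $\gamma^\sigma$ is defined by $\int\varphi\,d\gamma^\sigma=\int\varphi(x_{\sigma(1)},\dots,x_{\sigma(N)})\,d\gamma$; $S_N\gamma=\frac1{N!}\sum_\sigma\gamma^\sigma$ (analogously $S_k$ on $X^k$, extended linearly to finite signed measures); $\mathcal P_{\mathrm{sym}}(X^N)=\{\gamma\in\mathcal P(X^N):S_N\gamma=\gamma\}$; $M_1\gamma$ is the marginal on the first coordinate. $\mathcal P_{\frac1N}(X)=\{\frac1N\sum_{i=1}^N\delta_{x_i}: x_1,\dots,x_N\in X\text{ not necessarily distinct}\}$, a narrowly closed subset of $\mathcal P(X)$. The constraint $\int\lambda\,d\alpha(\lambda)=\rho$ means $\int(\int\varphi\,d\lambda)\,d\alpha(\lambda)=\int\varphi\,d\rho$ for all $\varphi\in C_b(X)$. For $\lambda\in\mathcal P(X)$, $\lambda^{\otimes m}$ is the $m$-fold product (factor omitted if $m=0$) and $\mathrm{id}^{\otimes m}_\#\lambda$ the push-forward of $\lambda$ under $x\mapsto(x,\dots,x)\in X^m$. A partition of $j\in\mathbb N$ of length $n$ is $\mathbf p=(p_1\ge\dots\ge p_n)\in\mathbb N^n$ ($\mathbb N=\{1,2,\dots\}$)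 with $\sum p_i=j$; $n(\mathbf p)=n$; $\mathrm{Ran}\,\mathbf p$ is the set of values of its components and $|\mathbf p^{-1}(q)|$ the number of components equal to $q$. Define $$F_{N,k}(\lambda)=\frac{N^{k-1}}{\prod_{i=1}^{k-1}(N-i)}\Big[\lambda^{\otimes k}+\sum_{j=1}^{k-1}\frac{(-1)^j}{N^j}S_kP_j^{(k)}(\lambda)\Big],$$ $$P_j^{(k)}(\lambda)=\sum_{\substack{\mathbf p\text{ partition of }j\\ j+n(\mathbf p)\le k}}d_{\mathbf p}^{(k)}\,\mathrm{id}^{\otimes(p_1+1)}_\#\lambda\otimes\cdots\otimes\mathrm{id}^{\otimes(p_{n(\mathbf p)}+1)}_\#\lambda\otimes\lambda^{\otimes(k-j-n(\mathbf p))},$$ $$d_{\mathbf p}^{(k)}=\frac{k!}{(k-j-n(\mathbf p))!}\prod_{i=1}^{n(\mathbf p)}\frac1{p_i+1}\prod_{q\in\mathrm{Ran}\,\mathbf p}\frac1{(|\mathbf p^{-1}(q)|)!}.$$ *)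

(* Defs.v *)
From HB Require Import structures.
From mathcomp Require Import all_boot all_order all_algebra all_fingroup.
From mathcomp Require Import all_classical all_reals all_analysis.

Set Implicit Arguments.
Unset Strict Implicit.
Unset Printing Implicit Defensive.

Import Order.TTheory GRing.Theory Num.Theory.
Import numFieldNormedType.Exports.

Local Open Scope classical_set_scope.
Local Open Scope ring_scope.

Section polish.
Context (R : realType).

Definition is_metric (T : Type) (d : T -> T -> R) : Prop :=
  [/\ forall x y, 0 <= d x y,
      forall x y, d x y = 0 <-> x = y,
      forall x y, d x y = d y x &
      forall x y z, d x z <= d x y + d y z].

Definition metrizes (T : topologicalType) (d : T -> T -> R) : Prop :=
  forall x (A : set T),
    nbhs x A <-> exists2 e : R, 0 < e & [set y | d x y < e] `<=` A.

Definition complete_metric (T : topologicalType) (d : T -> T -> R) : Prop :=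
  forall u : nat -> T,
    (forall e : R, 0 < e -> exists n0, forall m n, (n0 <= m)%N -> (n0 <= n)%N ->
       d (u m) (u n) < e) ->
    exists l : T, u @ \oo --> l.

Definition separable (T : topologicalType) : Prop :=
  exists2 D : set T, countable D & dense D.

Definition completely_metrizable (T : topologicalType) : Prop :=
  exists d : T -> T -> R,
    [/\ is_metric d, metrizes d & complete_metric d].

End polish.

(* Measurable types of the library are pointed, hence the pointed base type;
   an empty Polish space carries no probability measure. *)
HB.mixin Record isPolish (R : realType) T & PointedTopological T := {
  polish_separable : separable T;
  polish_completely_metrizable : completely_metrizable R T
}.

#[short(type="polishType")]
HB.structure Definition Polish (R : realType) :=
  {T of PointedTopological T & isPolish R T}.

Definition pow (T : Type) (n : nat) : Type := 'I_n -> T.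

HB.instance Definition _ (T : topologicalType) n :=
  Topological.copy (pow T n) (prod_topology (fun _ : 'I_n => T)).
HB.instance Definition _ (T : ptopologicalType) n :=
  isPointed.Build (pow T n) (fun=> point).

Notation borel T := (g_sigma_algebraType (@open T)).

Section continuous_maps.
Context (S T : ptopologicalType) (f : S -> T).
Hypothesis cf : continuous f.

Lemma continuous_borel :
  measurable_fun [set: borel S] (f : borel S -> borel T).
Proof.
apply: (@measurability _ _ (borel S) (borel T) setT f (@open T)) => //.
move=> _ [A oA <-]; rewrite setTI; apply: sub_sigma_algebra.
by move/continuousP: cf; apply.
Qed.

Definition cmfun : {mfun borel S >-> borel T} :=
  mfun_Sub (mem_set continuous_borel :
    (f : borel S -> borel T) \in @mfun _ _ (borel S) (borel T)).

End continuous_maps.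

Section concatenation.
Context (R : realType) (X : polishType R).

Lemma polish_basis : exists B : nat * nat -> set X,
  (forall n, open (B n)) /\
  forall x A, nbhs x A -> exists n, B n x /\ B n `<=` A.
Proof.
have [D cD dD] := @polish_separable R X.
have [d [[d0 deq dsym dtri] dnbhs _]] := @polish_completely_metrizable R X.
have /countable_injP[f finj] := cD.
pose g n : X := xget point [set x | D x /\ f x = n].
have gf x : D x -> g (f x) = x.
  move=> Dx; rewrite /g; case: xgetP => [y _ [Dy fyx]|/(_ x)/=].
    by apply: finj; rewrite ?inE.
  by move=> /not_andP[].
exists (fun p => [set y | d (g p.1) y < (p.2.+1%:R)^-1]).
have oB (c : X) (r : R) : open [set y | d c y < r].
  rewrite openE => y /= cy; rewrite /interior dnbhs.
  exists (r - d c y); first by rewrite subr_gt0.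
  by move=> z /= yz; rewrite (le_lt_trans (dtri c y z))// addrC -ltrBrDr.
split => [n|x A]; first exact: oB.
rewrite dnbhs => -[e e0 eA].
have [m me] : exists m : nat, (m.+1%:R)^-1 + (m.+1%:R)^-1 < e :> R.
  have e20 : 0 < e / 2 by rewrite divr_gt0.
  exists (Num.truncn (e / 2)^-1).
  rewrite [ltRHS]splitr ltrD// -[ltRHS]invrK ltf_pV2 ?posrE ?invr_gt0//.
  - by rewrite truncnS_gt.
  - by rewrite truncnS_gt.
have [|y [/= xy Dy]] := dD [set y | d x y < (m.+1%:R)^-1] _ (oB _ _).
  by exists x => /=; rewrite (deq x x).2.
exists (f y, m); rewrite /= gf//; split; first by rewrite dsym.
move=> z /= yz; apply: eA => /=.
by rewrite (le_lt_trans (dtri x y z))// (lt_trans _ me)// ltrD.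
Qed.

Lemma pow_nbhs n (x : pow X n) (A : set (pow X n)) : nbhs x A ->
  exists2 V : 'I_n -> set X, forall i, nbhs (x i) (V i) &
    [set y : pow X n | forall i, V i (y i)] `<=` A.
Proof.
move=> xA.
pose F : set_system (pow X n) := filter_from
  [set V : 'I_n -> set X | forall i, nbhs (x i) (V i)]
  (fun V => [set y | forall i, V i (y i)]).
have FF : Filter F.
  apply: filter_from_filter; first by exists (fun=> setT) => i; exact: filterT.
  move=> V W xV xW; exists (fun i => V i `&` W i).
    by move=> i; exact: filterI.
  by move=> y /= VWy; split=> i; have [] := VWy i.
suff /(_ A xA)[V xV VA] : F --> x by exists V.
apply/(@cvg_sup _ _ _ F x FF) => i.
move=> B [C [[U oU <-] xU UB]].
exists (fun j => if j == i then U else setT).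
  move=> j /=; case: eqP => [->|_]; last exact: filterT.
  exact: open_nbhs_nbhs.
by move=> y /= /(_ i); rewrite eqxx => Uy; exact: UB.
Qed.

Context (m n : nat).

Definition pow_cat (z : pow X m * pow X n) : pow X (m + n) :=
  fun i => match fintype.split i with inl j => z.1 j | inr j => z.2 j end.

(* This rests on the second countability of X. *)
Lemma measurable_pow_cat : measurable_fun [set: borel (pow X m) * borel (pow X n)]
  (pow_cat : borel (pow X m) * borel (pow X n) -> borel (pow X (m + n))).
Proof.
apply: (@measurability _ _ (borel (pow X m) * borel (pow X n))%type
  (borel (pow X (m + n))) setT pow_cat (@open (pow X (m + n)))) => //.
move=> _ [A oA <-]; rewrite setTI.
have [B [oB Bnbhs]] := polish_basis.
pose box (t : {ffun 'I_(m + n) -> nat * nat}) :=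
  [set y : pow X (m + n) | forall i, B (t i) (y i)].
have -> : A = \bigcup_(t in [set t | box t `<=` A]) box t.
  apply/seteqP; split=> [y Ay|y [t /= tA]]; last exact: tA.
  have /pow_nbhs[V yV VA] : nbhs y A by exact: open_nbhs_nbhs.
  have /choice[t ht] : forall i, exists k, B k (y i) /\ B k `<=` V i.
    by move=> i; exact: Bnbhs.
  exists [ffun i => t i] => /=.
    by move=> z zt; apply: VA => i; have := zt i; rewrite ffunE; apply: (ht i).2.
  by move=> i; rewrite ffunE; exact: (ht i).1.
rewrite preimage_bigcup bigcup_mkcond.
apply: countable_bigcupT_measurable => // t.
case: ifPn => // _.
have -> : pow_cat @^-1` box t =
  [set x : pow X m | forall i, B (t (lshift n i)) (x i)] `*`
  [set y : pow X n | forall i, B (t (rshift m i)) (y i)].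
  apply/seteqP; split=> [z /= zt|z [z1 z2] i].
    split=> /= i.
      have := zt (lshift n i); rewrite /pow_cat.
      by rewrite -[lshift n i]/(unsplit (inl i)) unsplitK.
    have := zt (rshift m i); rewrite /pow_cat.
    by rewrite -[rshift m i]/(unsplit (inr i)) unsplitK.
  by rewrite /pow_cat; case: split_ordP => j ->; [exact: z1|exact: z2].
have mbox (p : nat) (s : 'I_p -> nat * nat) :
    measurable ([set x | forall i, B (s i) (x i)] : set (borel (pow X p))).
  have -> : [set x : pow X p | forall i, B (s i) (x i)] =
      \bigcap_(i in [set: 'I_p]) ((fun x : pow X p => x i) @^-1` B (s i)).
    by apply/seteqP; split=> x /= xs i => [_|]; exact: xs.
  apply: fin_bigcap_measurable => // i _; apply: sub_sigma_algebra.
  apply: open_comp => // x _.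
  exact: (@proj_continuous _ (fun=> X) i).
by apply: measurableX; exact: mbox.
Qed.

End concatenation.

Section prob.
Context (R : realType).

Definition bounded_continuous (T : topologicalType) (f : T -> R) : Prop :=
  continuous f /\ exists M : R, forall x, `|f x| <= M.

Definition Cb (T : topologicalType) : Type :=
  {f : T -> R | bounded_continuous f}.

(* The map sending mu to (phi |-> \int phi dmu); its initial topology is the
   narrow topology. *)
Definition test (T : ptopologicalType) (mu : probability (borel T) R) :
    prod_topology (fun _ : Cb T => R) :=
  fun phi => \int[mu]_x (sval phi) x.

(* Library measures are functions of all sets, not only of the measurable ones.
   Hence equalities of probabilities are stated below on Borel sets; the values
   on other sets are not seen by the narrow topology. *)
Definition Prob (T : ptopologicalType) : Type := initial_topology (@test T).

HB.instance Definition _ (T : ptopologicalType) := Topological.on (Prob T).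
HB.instance Definition _ (T : ptopologicalType) := Pointed.on (Prob T).

End prob.

Section operations.
Context (R : realType).

Lemma continuous_coord (T : topologicalType) n (i : 'I_n) :
  continuous (fun x : pow T n => x i).
Proof. exact: (@proj_continuous _ (fun=> T) i). Qed.

Lemma continuous_pow (S T : topologicalType) n (f : S -> pow T n) :
  (forall i, continuous (fun s => f s i)) -> continuous f.
Proof.
move=> cf x; apply/cvg_sup => i A [B [[U oU <-] xU UB]].
have fxU : nbhs x ((fun s => f s i) @^-1` U).
  by apply: (cf i x); exact: open_nbhs_nbhs.
by apply: filterS fxU => y /= yU; exact: UB.
Qed.

Definition reindex (T : Type) m n (s : 'I_m -> 'I_n) (x : pow T n) : pow T m :=
  fun i => x (s i).

Lemma continuous_reindex (T : topologicalType) m n (s : 'I_m -> 'I_n) :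
  continuous (@reindex T m n s).
Proof. by apply: continuous_pow => i; exact: continuous_coord. Qed.

Definition diag (T : Type) n (x : T) : pow T n := fun=> x.

Lemma continuous_diag (T : topologicalType) n : continuous (@diag T n).
Proof. by apply: continuous_pow => i x; exact: cvg_id. Qed.

Definition push (S T : ptopologicalType) (f : S -> T) (cf : continuous f)
    (mu : Prob R S) : Prob R T :=
  distribution mu (cmfun cf).

Definition charge_add d (T : measurableType d) (n1 n2 : {charge set T -> \bar R})
  : {charge set T -> \bar R} := cadd n1 n2.

Definition charge_scale d (T : measurableType d) (r : R)
  (nu : {charge set T -> \bar R}) : {charge set T -> \bar R} := cscale r nu.

Definition charge_zero d (T : measurableType d) : {charge set T -> \bar R} :=
  czero.

Definition charge_push d d' (T : measurableType d) (T' : measurableType d')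
  (f : {mfun T >-> T'}) (nu : {charge set T -> \bar R})
  : {charge set T' -> \bar R} :=
  measure_function_pushforward__canonical__charge_Charge nu
    (measurable_funPT f).

Definition charge_of (T : ptopologicalType) (mu : Prob R T) :
    {charge set (borel T) -> \bar R} :=
  charge_of_finite_measure mu.

(* Integral against a signed measure through its Jordan decomposition; it does
   not depend on the Hahn decomposition that is picked. *)
Definition charge_integral d (T : measurableType d)
    (nu : {charge set T -> \bar R}) (f : T -> R) : \bar R :=
  let P := cid (Hahn_decomposition nu) in
  let N := cid (svalP P) in
  (\int[jordan_pos (svalP N)]_x (f x)%:E
   - \int[jordan_neg (svalP N)]_x (f x)%:E)%E.

End operations.
Arguments charge_zero {R d T}.

Section symmetrization.
Context (R : realType) (X : ptopologicalType).

(* gamma^sigma, with sigma acting on x by (x_{sigma(1)}, ..., x_{sigma(n)}) *)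
Definition charge_perm n (s : 'S_n) (nu : {charge set (borel (pow X n)) -> \bar R}) :
    {charge set (borel (pow X n)) -> \bar R} :=
  charge_push (cmfun (@continuous_reindex X n n s)) nu.

Definition charge_sym n (nu : {charge set (borel (pow X n)) -> \bar R}) :
    {charge set (borel (pow X n)) -> \bar R} :=
  charge_scale (n`!%:R)^-1
    (\big[@charge_add _ _ _/charge_zero]_(s : 'S_n) charge_perm s nu).

Definition Prob_sym n : set (Prob R (pow X n)) :=
  [set gamma | forall A : set (borel (pow X n)), measurable A ->
     charge_sym (charge_of gamma) A = gamma A].

Definition marginal n (i : 'I_n) (gamma : Prob R (pow X n)) : Prob R X :=
  push (@continuous_coord X n i) gamma.

Definition symmetric_fun n (Phi : pow X n -> R) : Prop :=
  forall (s : 'S_n) (x : pow X n), Phi (reindex s x) = Phi x.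

End symmetrization.

Section products.
Context (R : realType) (X : polishType R).

Definition prob_prod m n (mu : Prob R (pow X m)) (nu : Prob R (pow X n)) :
    Prob R (pow X (m + n)) :=
  distribution (mu \x nu)%E (mfun_Sub (mem_set (@measurable_pow_cat R X m n))).

Definition prob_diag n (lambda : Prob R X) : Prob R (pow X n) :=
  push (@continuous_diag X n) lambda.

(* X^0 is a point: multiplying by its Dirac mass amounts to omitting the
   factor. *)
Definition prob_pow0 : Prob R (pow X 0) := \d_(point : borel (pow X 0)).

Fixpoint prob_pow (lambda : Prob R X) (m : nat) : Prob R (pow X m) :=
  if m is m'.+1 then prob_prod (prob_diag 1 lambda) (prob_pow lambda m')
  else prob_pow0.

(* The product of the id^{(p_i+1)}_# lambda over the parts p_i of p. *)
Fixpoint prob_blocks (lambda : Prob R X) (p : seq nat) :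
    Prob R (pow X (sumn (map succn p))) :=
  if p is q :: p' then prob_prod (prob_diag q.+1 lambda) (prob_blocks lambda p')
  else prob_pow0.

Definition prob_cast m n (e : m = n) (mu : Prob R (pow X m)) :
    Prob R (pow X n) :=
  ecast i (Prob R (pow X i)) e mu.

End products.

Definition is_partition (j : nat) (p : seq nat) : bool :=
  [&& sorted geq p, all (leq 1) p & sumn p == j].

(* The partitions of j of length n with j + n <= k; a part of j is at most j,
   whence the finite type. *)
Definition int_partition (k j n : nat) : Type :=
  {p : n.-tuple 'I_j.+1 | is_partition j (map val p) && (j + n <= k)%N}.

HB.instance Definition _ k j n := Finite.on (int_partition k j n).

Definition parts k j n (p : int_partition k j n) : seq nat := map val (sval p).

Lemma sumn_parts k j n (p : int_partition k j n) :
  (sumn (map succn (parts p)) + (k - j - n) = k)%N.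
Proof.
rewrite /parts; case: p => p /= /andP[/and3P[_ _ /eqP pj] jnk].
have -> (s : seq nat) : sumn (map succn s) = (sumn s + size s)%N.
  by elim: s => //= q s ->; rewrite addSn addnS addnA.
by rewrite pj size_map size_tuple -subnDA subnKC.
Qed.

Section functional.
Context (R : realType) (X : polishType R).

(* size p is the length of p, undup p lists its set of values. *)
Definition dcoef (k j : nat) (p : seq nat) : R :=
  k`!%:R / (k - j - size p)`!%:R
  * (\prod_(a <- p) (a.+1%:R)^-1)
  * (\prod_(q <- undup p) ((count_mem q p)`!%:R)^-1).

Definition Pj (k j : nat) (lambda : Prob R X) :
    {charge set (borel (pow X k)) -> \bar R} :=
  \big[@charge_add _ _ _/charge_zero]_(n < k.+1)
   \big[@charge_add _ _ _/charge_zero]_(p : int_partition k j n)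
     charge_scale (dcoef k j (parts p))
       (charge_of (prob_cast (sumn_parts p)
          (prob_prod (prob_blocks lambda (parts p))
                     (prob_pow lambda (k - j - n))))).

Definition FNk (N k : nat) (lambda : Prob R X) :
    {charge set (borel (pow X k)) -> \bar R} :=
  charge_scale (N%:R ^+ k.-1 / \prod_(1 <= i < k) (N%:R - i%:R))
    (charge_add (charge_of (prob_pow lambda k))
       (\big[@charge_add _ _ _/charge_zero]_(1 <= j < k)
          charge_scale ((-1) ^+ j / N%:R ^+ j) (charge_sym (Pj k j lambda)))).

Definition increasing k N (s : {ffun 'I_k -> 'I_N}) : bool :=
  [forall a : 'I_k, forall b : 'I_k, (a < b)%N ==> (s a < s b)%N].

Definition cost (N k : nat) (Phi : pow X k -> R) (x : pow X N) : R :=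
  ('C(N, k)%:R)^-1 *
  \sum_(s : {ffun 'I_k -> 'I_N} | increasing s) Phi (reindex s x).

Definition CNk (N k : nat) (N_gt0 : (0 < N)%N) (Phi : pow X k -> R)
    (rho : Prob R X) : \bar R :=
  ereal_inf [set (\int[gamma]_x (cost Phi x)%:E)%E | gamma in
    [set gamma : Prob R (pow X N) | Prob_sym gamma /\
       forall A : set (borel X), measurable A ->
         marginal (Ordinal N_gt0) gamma A = rho A]].

Definition empirical (N : nat) : set (Prob R X) :=
  [set lambda | exists x : pow X N,
     forall A : set (borel X), measurable A ->
       lambda A = ((N%:R)^-1%:E * \sum_(i < N) \d_(x i : borel X) A)%E].

(* The type is indexed by a proof of 0 < N since it must be inhabited. *)
Definition Empirical (N : nat) (N_gt0 : (0 < N)%N) : Type :=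
  set_type (empirical N).

HB.instance Definition _ N (N_gt0 : (0 < N)%N) :=
  Topological.copy (Empirical N_gt0) (set_type (empirical N)).

Lemma empirical_point N (N_gt0 : (0 < N)%N) :
  (\d_(point : borel X) : Prob R X) \in empirical N.
Proof.
apply/mem_set; exists (fun=> point) => A mA.
rewrite diracE sumEFin sumr_const card_ord -EFinM -[X in _ * X]mulr_natl mulrA.
by rewrite mulVf ?mul1r// pnatr_eq0 -lt0n.
Qed.

HB.instance Definition _ N (N_gt0 : (0 < N)%N) :=
  isPointed.Build (Empirical N_gt0)
    (exist (fun lambda => lambda \in empirical N) _ (empirical_point N_gt0)).

(* The constraint \int lambda dalpha(lambda) = rho. *)
Definition barycenter N (N_gt0 : (0 < N)%N)
    (alpha : Prob R (Empirical N_gt0)) (rho : Prob R X) : Prop :=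
  forall phi : X -> R, bounded_continuous phi ->
    (\int[alpha]_lambda (\int[\val lambda]_x (phi x)%:E) =
     \int[rho]_x (phi x)%:E)%E.

End functional.

Arguments Empirical R X {N} N_gt0.

Lemma lt0N (N k : nat) : (2 <= k)%N -> (k <= N)%N -> (0 < N)%N.
Proof. by move=> /ltnW; exact: leq_trans. Qed.

(* Main.v *)
(* Let [lambda = 1/N sum_i delta_(x_i)].  Expanding the products of
   diagonal push-forwards of [lambda] turns [F_(N,k)(lambda)] tested against a
   symmetric [Phi] into the expression of the elementary symmetric function
   [e_k] in terms of power sums, read through the linear map sending the
   monomial of a word [i_1 ... i_k] to [Phi(x_(i_1), ..., x_(i_k))].  Newton's
   identities thus show that the integral is [c_Phi(x_1, ..., x_N)].

   A symmetric plan [gamma] is pushed to a law [alpha] on empirical measures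
   by [x |-> 1/N sum_i delta_(x_i)], which is continuous.  Conversely, [alpha]
   is sent to the mixture of the symmetrised Dirac masses of the
   configurations underlying its empirical measures.  That these form a
   measurable kernel follows again from the formula, now with [k = N]: the
   mass of a Borel set is the integral of a symmetric function against
   [F_(N,N)(lambda)], hence a combination of integrals against products of
   push-forwards of [lambda], which depend measurably on [lambda].  Both maps
   preserve the constraint and the cost, so that the two sets of values have
   the same infimum. *)

From HB Require Import structures.
Require Import Defs.
From mathcomp Require Import all_boot all_order all_algebra all_fingroup.
From mathcomp Require Import all_classical all_reals all_analysis.
From mathcomp Require Import measurable_realfun giry ring zify.

Set Implicit Arguments.
Unset Strict Implicit.
Unset Printing Implicit Defensive.

Import Order.TTheory GRing.Theory Num.Theory.
Import numFieldNormedType.Exports.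

Local Open Scope classical_set_scope.
Local Open Scope ring_scope.

(** * Newton's identities for symmetric functions of words *)

Section newton.
Context (F : comPzRingType) (T : finType).
Implicit Types (Psi : seq T -> F) (r : seq nat).

Definition perm_invariant Psi := forall s t, perm_eq s t -> Psi s = Psi t.

(* [elem_sum m], [power_sum r] and [mixed_sum m i] are the images, under the
   linear map sending the monomial of a word [l] to [Psi l], of e_m, of the
   product of the p_q for q in r, and of the sum over a of a^i times e_m in the
   variables other than a. *)
Definition elem_sum (m : nat) Psi : F := \sum_(A :
  {set T} | #|A| == m) Psi (enum A).

Fixpoint power_sum r Psi : F :=
  if r is q :: r' then \sum_a power_sum r' (fun l => Psi (nseq q a ++ l))
  else Psi [::].

Definition mixed_sum (m i : nat) Psi : F :=
  \sum_a \sum_(A : {set T} | (#|A| == m) && (a \notin A))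
    Psi (nseq i a ++ enum A).

Lemma perm_invariant_cat Psi l : perm_invariant Psi ->
  perm_invariant (fun s => Psi (l ++ s)).
Proof. by move=> iPsi s t st; apply: iPsi; rewrite perm_cat2l. Qed.

Lemma enum_setU1 (a : T) (A : {set T}) : a \notin A ->
  perm_eq (enum (a |: A)) (a :: enum A).
Proof.
move=> aA; apply: uniq_perm; rewrite ?enum_uniq//= ?enum_uniq ?mem_enum ?aA//.
by move=> x; rewrite !(inE, mem_enum).
Qed.

Lemma setU1_sum m (a : T) (G : {set T} -> F) :
  \sum_(A : {set T} | (#|A| == m.+1) && (a \in A)) G A =
  \sum_(A : {set T} | (#|A| == m) && (a \notin A)) G (a |: A).
Proof.
rewrite (reindex_onto (fun A => a |: A) (fun A => A :\ a)) /=; last first.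
  by move=> A /andP[_ aA]; rewrite finset.setD1K.
apply: eq_bigl => A; rewrite finset.setU11 andbT cardsU1.
apply/andP/andP => [[/eqP h /eqP e]|[/eqP h aA]].
  have aA : a \notin A by rewrite -e !inE eqxx.
  by rewrite aA; move: h; rewrite aA add1n => -[->].
by rewrite aA h add1n eqxx finset.setU1K.
Qed.

(** Split the sets of size [m.+1] according to whether they contain [a]. Those avoiding [a] form the
    left-hand side; in the others [a] moves to the prefix, which gives [mixed_sum m i.+1]. *)
Lemma mixed_sum_rec m i Psi : perm_invariant Psi ->
  mixed_sum m.+1 i Psi =
  \sum_a elem_sum m.+1 (fun l => Psi (nseq i a ++ l)) - mixed_sum m i.+1 Psi.
Proof.
move=> iPsi; apply/eqP; rewrite eq_sym subr_eq -big_split/=; apply/eqP.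
apply: eq_bigr => a _.
rewrite /elem_sum (bigID (fun A : {set T} => a \notin A))/=; congr (_ + _).
under eq_bigl => A do rewrite negbK.
rewrite setU1_sum; apply: eq_bigr => A /andP[_ aA]; apply: iPsi.
by rewrite -[a :: _ ++ _]cat1s perm_sym perm_catCA perm_cat2l perm_sym enum_setU1.
Qed.

Lemma mixed_sum0 i Psi :
  mixed_sum 0 i Psi = \sum_a elem_sum 0 (fun l => Psi (nseq i a ++ l)).
Proof.
apply: eq_bigr => a _; apply: eq_bigl => A.
by case: eqP => //= /cards0_eq ->; rewrite inE.
Qed.

(** Moving [a] back into the set, each set of size [m.+1] arises once for each of its elements. *)
Lemma mixed_sum1 m Psi : perm_invariant Psi ->
  mixed_sum m 1 Psi = m.+1%:R * elem_sum m.+1 Psi.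
Proof.
move=> iPsi; rewrite /mixed_sum.
under eq_bigr => a _.
  under eq_bigr => A /andP[_ aA] do rewrite -(iPsi _ _ (enum_setU1 aA)).
  rewrite -(setU1_sum _ a (fun A => Psi (enum A))).
  over.
rewrite (exchange_big_dep (fun A : {set T} => #|A| == m.+1))/=; last first.
  by move=> ? ? _ /andP[].
rewrite mulr_sumr; apply: eq_bigr => A /eqP cA.
by rewrite (eq_bigl (mem A)) => [|a]; rewrite ?cA ?eqxx// sumr_const cA mulr_natl.
Qed.

Lemma mixed_sumE m i Psi : perm_invariant Psi ->
  mixed_sum m i Psi = \sum_(l < m.+1)
    (-1) ^+ l * \sum_a elem_sum (m - l)%N (fun s => Psi (nseq (i + l) a ++ s)).
Proof.
move=> iPsi; elim: m i => [|m IH] i.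
  by rewrite mixed_sum0 big_ord1 expr0 mul1r addn0.
rewrite mixed_sum_rec// IH [RHS]big_ord_recl/= expr0 mul1r addn0 subn0;
  congr (_ + _).
rewrite -sumrN; apply: eq_bigr => l _.
by rewrite /bump/= add1n subSS exprS mulN1r mulNr addnS.
Qed.

(** In the classical notation, $(m+1) e_{m+1} = \sum_i (-1)^i p_{i+1} e_{m-i}$. The mixed sum with
    exponent 1 is computed in two ways: by counting, and by unrolling its recursion. *)
Lemma newton m Psi : perm_invariant Psi ->
  m.+1%:R * elem_sum m.+1 Psi = \sum_(i < m.+1)
    (-1) ^+ i * \sum_a elem_sum (m - i)%N (fun s => Psi (nseq i.+1 a ++ s)).
Proof.
move=> iPsi; by rewrite -mixed_sum1// mixed_sumE//.
Qed.

Lemma power_sum_ext r Psi Psi' : Psi =1 Psi' -> power_sum r Psi = power_sum r Psi'.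
Proof.
elim: r Psi Psi' => //= q r IH Psi Psi' e.
by apply: eq_bigr => a _; apply: IH => l; exact: e.
Qed.

(** This is commutativity of the product of power sums. Two neighbouring exponents are exchanged by
    exchanging the two sums; any exponent can thus be brought to the head. *)
Lemma power_sum_perm r r' Psi : perm_invariant Psi -> perm_eq r r' ->
  power_sum r Psi = power_sum r' Psi.
Proof.
have cons2 p q s Psi' : perm_invariant Psi' ->
    power_sum (p :: q :: s) Psi' = power_sum (q :: p :: s) Psi'.
  move=> iP /=; rewrite exchange_big/=; apply: eq_bigr => b _.
  apply: eq_bigr => a _; apply: power_sum_ext => l; apply: iP.
  by rewrite perm_catCA.
have headr p s t Psi' : perm_invariant Psi' ->
    power_sum (s ++ p :: t) Psi' = power_sum (p :: s ++ t) Psi'.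
  elim: s Psi' => // q s IH Psi' iP.
  rewrite cat_cons cons2//=; apply: eq_bigr => a _.
  by rewrite IH//; exact: perm_invariant_cat.
elim: r r' Psi => [|q r IH] r' Psi iPsi rr'.
  by rewrite perm_sym in rr'; rewrite (perm_nilP rr').
have qr' : q \in r' by rewrite -(perm_mem rr') mem_head.
case/splitPr: qr' rr' => s t rr'.
rewrite headr//=; apply: eq_bigr => a _; apply: IH.
  exact: perm_invariant_cat.
by move: rr'; rewrite perm_sym -cat1s perm_catCA/= perm_cons perm_sym.
Qed.

End newton.

(** * Sums over partitions *)

Section partitions.
Implicit Types (r : seq nat).

(** A finite supply of candidates: a partition of [m] has at most [m] parts, each at most [m]. *)
Definition bounded_seqs m : seq (seq nat) :=
  flatten [seq [seq map val (val t) | t <- enum {:n.-tuple 'I_m.+1}]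
          | n <- iota 0 m.+1].

Definition partitions m : seq (seq nat) :=
  [seq r <- undup (bounded_seqs m) | is_partition m r].

Lemma partitions_uniq m : uniq (partitions m).
Proof. by rewrite filter_uniq// undup_uniq. Qed.

Lemma size_le_sumn r : all (leq 1) r -> (size r <= sumn r)%N.
Proof. by elim: r => //= q r IH /andP[q1 /IH]; lia. Qed.

Lemma mem_le_sumn r q : q \in r -> (q <= sumn r)%N.
Proof.
elim: r => //= p r IH; rewrite inE => /orP[/eqP ->|/IH]; lia.
Qed.

Lemma bounded_seqsP m n r : (n <= m)%N -> size r = n ->
  (forall q, q \in r -> (q <= m)%N) ->
  exists t : n.-tuple 'I_m.+1, r = map val (val t).
Proof.
move=> nm rn rm.
have sz : size (map (@inord m) r) == n by rewrite size_map rn.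
exists (Tuple sz) => /=; rewrite -map_comp map_id_in// => q /rm qm /=.
by rewrite inordK.
Qed.

Lemma mem_partitions m r : (r \in partitions m) = is_partition m r.
Proof.
rewrite mem_filter mem_undup andb_idr// => /and3P[_ r1 /eqP rm].
have szr : (size r <= m)%N by rewrite -rm size_le_sumn.
have [q|t tE] := @bounded_seqsP m _ r szr erefl.
  by rewrite -rm; exact: mem_le_sumn.
apply/flattenP; exists [seq map val (val t) | t <- enum {:(size r).-tuple 'I_m.+1}].
  by apply/mapP; exists (size r); rewrite ?mem_iota//= add0n ltnS.
by apply/mapP; exists t; rewrite ?mem_enum.
Qed.

Lemma geq_total : total geq. Proof. by move=> m n; exact: leq_total. Qed.
Lemma geq_trans : transitive geq.
Proof. by move=> m n p /= mn /leq_trans; apply. Qed.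
Lemma geq_anti : antisymmetric geq.
Proof. by move=> m n; rewrite /= andbC => /anti_leq. Qed.

Lemma sumn_perm r (p : seq nat) : perm_eq r p -> sumn r = sumn p.
Proof. by move=> rp; rewrite !sumnE; exact: perm_big. Qed.

Lemma sumn_rem q r : q \in r -> (q + sumn (rem q r) = sumn r)%N.
Proof. by move=> qr; rewrite [RHS](sumn_perm (perm_to_rem qr)). Qed.

(** Inserting a part [i.+1] and sorting again is inverse to deleting it. This matches the terms of
    $e_{m-i}$ in Newton's identity with partitions of [m.+1]. *)
Lemma rem_partitions m (i : 'I_m.+1) :
  perm_eq [seq rem i.+1 r | r <- partitions m.+1 & i.+1 \in r]
    (partitions (m - i)).
Proof.
apply: uniq_perm => [||p].
- rewrite map_inj_in_uniq ?(filter_uniq _ (partitions_uniq _))// => r p.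
  rewrite [r \in _]mem_filter [p \in _]mem_filter !mem_partitions =>
    /andP[ir /and3P[sr _ _]].
  move=> /andP[ip /and3P[sp _ _]] e.
  apply: (sorted_eq geq_trans geq_anti) => //.
  by rewrite (permPl (perm_to_rem ir)) e perm_sym perm_to_rem.
- exact: partitions_uniq.
- apply/mapP/idP => [[r]|].
    rewrite mem_filter !mem_partitions => /andP[ir /and3P[sr r1 /eqP rm]] ->.
    apply/and3P; split.
    + by apply: subseq_sorted sr; [exact: geq_trans|exact: rem_subseq].
    + by apply/allP => q /mem_rem; move/allP: r1; apply.
    + by have := sumn_rem ir; rewrite rm => e; apply/eqP; have := ltn_ord i; lia.
  rewrite mem_partitions => /and3P[sp p1 /eqP pm].
  have iS : i.+1 \in sort geq (i.+1 :: p) by rewrite mem_sort mem_head.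
  have sS : sorted geq (sort geq (i.+1 :: p)) by exact/sort_sorted/geq_total.
  have eS := permEl (perm_sort geq (i.+1 :: p)).
  exists (sort geq (i.+1 :: p)).
    rewrite mem_filter iS mem_partitions /is_partition sS all_sort/= p1.
    by rewrite (sumn_perm eS)/= pm; have := ltn_ord i; lia.
  apply: (sorted_eq geq_trans geq_anti) => //.
    exact: (subseq_sorted geq_trans (rem_subseq _ _)) sS.
  by rewrite -(perm_cons i.+1) perm_sym -(permPl (perm_to_rem iS)).
Qed.

(* The order of the centraliser of a permutation of cycle type [r]. *)
Definition cycle_weight r : nat :=
  (\prod_(q <- r) q * \prod_(q <- undup r) (count_mem q r)`!)%N.

(** Absent values contribute $0! = 1$. Over a fixed range, the products of two lists can be compared
    factor by factor. *)
Lemma prod_count_fact r K : (forall q, q \in r -> (q < K)%N) ->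
  (\prod_(q <- undup r) (count_mem q r)`! =
    \prod_(q < K) (count_mem (q : nat) r)`!)%N.
Proof.
move=> rK; rewrite -(big_mkord xpredT (fun q =>
  (count_mem q r)`!)) [RHS](bigID (mem r))/=.
rewrite [X in (_ * X)%N]big1 ?muln1; last by move=> q /count_memPn ->.
rewrite -[RHS]big_filter; apply: perm_big; apply: uniq_perm.
- exact: undup_uniq.
- by rewrite filter_uniq// iota_uniq.
- move=> q; rewrite mem_undup mem_filter mem_index_iota leq0n/= andb_idr//.
  exact: rK.
Qed.

(** Deleting one part [q] divides the product of the parts by [q], and the factorial of the
    multiplicity of [q] by that multiplicity. *)
Lemma cycle_weight_rem q r : q \in r ->
  cycle_weight r = (q * count_mem q r * cycle_weight (rem q r))%N.
Proof.
move=> qr.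
pose K := (sumn r).+1.
have rK p : p \in r -> (p < K)%N by move=> /mem_le_sumn; rewrite ltnS.
rewrite /cycle_weight (prod_count_fact rK) (@prod_count_fact (rem q r) K);
  last first.
  by move=> p /mem_rem /rK.
rewrite (perm_big _ (perm_to_rem qr))/= big_cons.
rewrite -!mulnA; congr (_ * _)%N; rewrite mulnCA; congr (_ * _)%N.
pose Q := Ordinal (rK q qr).
rewrite (bigD1 Q)//= [in RHS](bigD1 Q)//= mulnA; congr (_ * _)%N.
  rewrite (seq.permP (perm_to_rem qr))/= eqxx add1n factS; congr (_ * _`!)%N.
apply: eq_bigr => p pQ; rewrite (seq.permP (perm_to_rem qr))/=.
by rewrite (_ : q == p = false)//; apply: contraNF pQ => /eqP qp; apply/eqP/val_inj.
Qed.

Lemma cycle_weight_gt0 r : all (leq 1) r -> (0 < cycle_weight r)%N.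
Proof.
move=> /allP r1; rewrite muln_gt0 [in X in X && _]big_seq; apply/andP; split.
  apply: prodn_cond_gt0 => q qr. by have := r1 _ qr.
by rewrite prodn_gt0// => q; rewrite fact_gt0.
Qed.

(** Grouping equal parts. The factor [m.+1] of Newton's identity is thereby distributed over the
    choices of a part to delete. *)
Lemma sumn_count m r : all (leq 1) r -> sumn r = m.+1 ->
  m.+1 = (\sum_(i < m.+1) i.+1 * count_mem i.+1 r)%N.
Proof.
move=> r1 rm.
have rk q : q \in r -> (q <= m.+1)%N by move=> /mem_le_sumn; rewrite rm.
rewrite -[LHS]rm; elim: r r1 rk {rm} => [_ _|q r IH /= /andP[q1 r1] rk].
  by rewrite big1// => i _; rewrite muln0.
rewrite IH//; last by move=> p pr; apply: rk; rewrite inE pr orbT.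
under [RHS]eq_bigr do rewrite mulnDr.
rewrite [RHS]big_split/=; congr (_ + _)%N.
have qm : (q.-1 < m.+1)%N by rewrite prednK// rk// mem_head.
rewrite (bigD1 (Ordinal qm))//= prednK// eqxx muln1 big1 ?addn0// => i iq.
rewrite (_ : q == i.+1 = false) ?muln0//; apply: contraNF iq => /eqP qi.
by apply/eqP/val_inj; rewrite /= qi.
Qed.

End partitions.

(** * Elementary symmetric functions in terms of power sums, and the coefficients of $F_{N,k}$ *)

Section expansion.
Context (F : realType) (T : finType).
Implicit Types (Psi : seq T -> F).

Lemma partitions0 : perm_eq (partitions 0) [:: [::]].
Proof.
apply: uniq_perm => [||r] //; first exact: partitions_uniq.
rewrite mem_partitions inE; apply/idP/eqP => [/and3P[_]|->//].
by case: r => //= q r /andP[q1 _] /eqP; lia.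
Qed.

(** Strong induction on [m] through Newton's identity: expanding $e_{m-i}$ and multiplying by
    $p_{i+1}$ produces the partitions of [m.+1] with a distinguished part [i.+1]. *)
Lemma elem_sum_power_sum m Psi : perm_invariant Psi ->
  elem_sum m Psi = \sum_(r <- partitions m)
    (-1) ^+ (m - size r) / (cycle_weight r)%:R * power_sum r Psi.
Proof.
elim/ltn_ind: m Psi => -[|m] IH Psi iPsi.
  rewrite (perm_big _ partitions0)/= big_seq1/= expr0 /cycle_weight !big_nil.
  rewrite divr1 mul1r /elem_sum (big_pred1 finset.set0).
    by rewrite enum_set0.
  by move=> A; rewrite cards_eq0.
have m0 : m.+1%:R != 0 :> F by rewrite pnatr_eq0.
apply: (mulfI m0); rewrite newton// mulr_sumr.
(* The share of the part size [i.+1] in the term of [r]; by [sumn_count] the shares add up to [m.+1]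
   times that term. *)
pose c r (i : 'I_m.+1) : F := (i.+1 * count_mem i.+1 r)%:R *
  ((-1) ^+ (m.+1 - size r) / (cycle_weight r)%:R * power_sum r Psi).
transitivity (\sum_(r <- partitions m.+1) \sum_i c r i); last first.
  rewrite !big_seq; apply: eq_bigr => r.
  rewrite mem_partitions => /and3P[_ r1 /eqP rm].
  by rewrite -mulr_suml -natr_sum -sumn_count.
rewrite exchange_big/=; apply: eq_bigr => i _.
rewrite [RHS](bigID (fun r => i.+1 \in r))/= [X in _ + X]big1 ?addr0; last first.
  by move=> r /count_memPn ir; rewrite /c ir muln0 mul0r.
(* For a partition [p] of [m - i], this is the term of [p] in $e_{m-i}$, multiplied by $p_{i+1}$ and
   by the sign $(-1)^i$ of Newton's identity. *)
pose g p : F := (-1) ^+ (m - size p) / (cycle_weight p)%:R *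
  power_sum (i.+1 :: p) Psi.
transitivity (\sum_(r <- partitions m.+1 | i.+1 \in r) g (rem i.+1 r)); last first.
  rewrite [LHS]big_seq_cond [RHS]big_seq_cond; apply: eq_bigr => r.
  rewrite mem_partitions => /andP[/and3P[_ r1 /eqP rm] ir].
  rewrite /c /g (power_sum_perm iPsi (perm_to_rem ir)) mulrA; congr (_ * _).
  rewrite (cycle_weight_rem ir) size_rem//.
  have r0 : (0 < size r)%N by case: (r) ir.
  rewrite [RHS]mulrCA (_ : m.+1 - size r = m - (size r).-1)%N; last by lia.
  congr (_ * _).
  have w0 : (cycle_weight (rem i.+1 r))%:R != 0 :> F.
    rewrite pnatr_eq0 -lt0n cycle_weight_gt0//.
    by apply/allP => q /mem_rem; move/allP: r1; apply.
  have i0 : (i.+1 * count_mem i.+1 r)%:R != 0 :> F.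
    by rewrite pnatr_eq0 muln_eq0/= -lt0n -has_count has_pred1.
  by rewrite (natrM _ (i.+1 * _)%N) invfM mulrA divff// mul1r.
rewrite -[RHS]big_filter -[RHS](big_map (rem i.+1) xpredT g) [RHS](perm_big _
  (rem_partitions i)).
rewrite [LHS]mulr_sumr.
under [LHS]eq_bigr => a _.
  rewrite IH; last 2 first.
  - by rewrite ltnS leq_subr.
  - exact: (perm_invariant_cat (nseq i.+1 a)).
  rewrite mulr_sumr.
  over.
rewrite exchange_big/= big_seq [RHS]big_seq; apply: eq_bigr => r.
rewrite mem_partitions => /and3P[_ /size_le_sumn + /eqP rm]; rewrite rm => rs.
rewrite /g/= mulr_sumr; apply: eq_bigr => a _; rewrite !mulrA; congr (_ / _ * _).
by rewrite -exprD; congr (_ ^+ _); have := ltn_ord i; lia.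
Qed.

Lemma sum_int_partition k j n (G : seq nat -> F) :
  \sum_(p : int_partition k j n) G (parts p) =
  \sum_(p <- partitions j | (j + size p <= k)%N && (size p == n)) G p.
Proof.
transitivity (\sum_(p <- [seq parts p | p : int_partition k j n]) G p).
  by rewrite big_map big_enum.
rewrite -[RHS]big_filter; apply: perm_big; apply: uniq_perm => [||p].
- rewrite map_inj_uniq ?enum_uniq// => p q /= pq; apply/val_inj/val_inj.
  exact: (inj_map val_inj) pq.
- exact: (filter_uniq _ (partitions_uniq _)).
rewrite mem_filter mem_partitions; apply/mapP/idP => [[q _ ->]|].
  have /andP[qj jnk] := valP q.
  by rewrite /parts/= qj size_map size_tuple eqxx jnk.
move=> /andP[/andP[pk /eqP pn] pj].
have /and3P[_ p1 /eqP sp] := pj.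
have szp : (size p <= j)%N by rewrite -sp size_le_sumn.
have [q|t tE] := @bounded_seqsP j _ p szp erefl.
  by rewrite -sp; exact: mem_le_sumn.
move: tE; rewrite -pn => tE.
have tP : is_partition j (map val t) && (j + size p <= k)%N by rewrite -tE pj.
by exists (exist _ t tP); rewrite ?mem_enum.
Qed.

(* A partition p of j with j + n(p) <= k encodes the partition of k with parts
   p_i + 1 completed by ones. *)
Definition full_partition k (p : seq nat) : seq nat :=
  map succn p ++ nseq (k - sumn p - size p) 1%N.

Lemma sumn_succ (p : seq nat) : sumn (map succn p) = (sumn p + size p)%N.
Proof. by elim: p => //= q p ->; lia. Qed.

Lemma sumn_full_partition k p : (sumn p + size p <= k)%N ->
  sumn (full_partition k p) = k.
Proof. by rewrite sumn_cat sumn_succ sumn_nseq; lia. Qed.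

Lemma size_full_partition k p : (sumn p + size p <= k)%N ->
  size (full_partition k p) = (k - sumn p)%N.
Proof. by rewrite size_cat size_map size_nseq; lia. Qed.

Lemma full_partitionK k p : all (leq 1) p ->
  map predn (seq.filter (leq 2) (full_partition k p)) = p.
Proof.
move=> p1; rewrite filter_cat map_cat.
rewrite [seq.filter _ (nseq _ _)](_ : _ = [::]) ?cats0; last first.
  by elim: (k - _ - _)%N => //= n ->.
by elim: p p1 => //= q p IH /andP[q1 /IH e]; rewrite ltnS q1/= e.
Qed.

Lemma sumn_filter_le r : all (leq 1) r ->
  (sumn r = sumn (map predn (seq.filter (leq 2) r)) + size r)%N.
Proof.
elim: r => //= q r IH /andP[q1 /IH ->]; case: ifP => /= q2; lia.
Qed.

Lemma size_filter_ge2 r : all (leq 1) r ->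
  (sumn (map predn (seq.filter (leq 2) r)) + size (seq.filter (leq 2) r) <= sumn
  r)%N.
Proof.
by elim: r => //= q r IH /andP[q1 /IH]; case: ifP => /= q2; lia.
Qed.

(** In a nonincreasing list of positive parts the ones form the tail. *)
Lemma filter_ge2_cat r : sorted geq r -> all (leq 1) r ->
  r = seq.filter (leq 2) r ++ nseq (size r - size (seq.filter (leq 2) r)) 1%N.
Proof.
elim: r => //= q r IH qr /andP[q1 r1]; have sr := path_sorted qr.
case: ifP => q2 /=; first by rewrite subSS -IH.
have q1' : q = 1%N by lia.
have {}r1 : all (pred1 1%N) r.
  apply/allP => p pr /=; move: (allP r1 _ pr) => /= p1.
  by have := allP (order_path_min geq_trans qr) _ pr; rewrite /= q1'; lia.
rewrite [seq.filter _ _](_ : _ = [::]).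
  by rewrite /= q1'; congr cons; apply/all_pred1P.
apply/eqP; rewrite -[_ == _]negbK -has_filter; apply/hasPn => p /(allP r1) /eqP ->.
by [].
Qed.

(** The inverse map drops the ones and lowers the other parts by one. A partition [r] of [k] comes
    from a partition of [k - size r], which is less than [k] because [r] is nonempty. *)
Lemma full_partition_perm k : (0 < k)%N ->
  perm_eq [seq full_partition k p | p <- flatten [seq partitions j | j <- iota 0 k]
             & (sumn p + size p <= k)%N] (partitions k).
Proof.
move=> k0.
have memP p : p \in flatten [seq partitions j | j <- iota 0 k] ->
    [/\ sorted geq p, all (leq 1) p & (sumn p < k)%N].
  case/flatten_mapP => j; rewrite mem_iota add0n => /andP[_ jk].
  by rewrite mem_partitions => /and3P[? ? /eqP ->].
apply: uniq_perm => [||r].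
- rewrite map_inj_in_uniq.
    apply: filter_uniq; elim: k {k0 memP} 0%N => //= k IH i.
    rewrite cat_uniq partitions_uniq IH andbT/=; apply/hasPn => p.
    case/flatten_mapP => j; rewrite mem_iota => /andP[ij _].
    rewrite /= !mem_partitions => /and3P[_ _ /eqP pj]; apply/negP => /and3P[_ _].
    by rewrite pj; lia.
  move=> p q; rewrite !mem_filter => /andP[_ /memP[_ p1 _]].
  move=> /andP[_ /memP[_ q1 _]] e.
  by rewrite -(full_partitionK k p1) e full_partitionK.
- exact: partitions_uniq.
rewrite mem_partitions; apply/mapP/idP => [[p]|].
  rewrite mem_filter => /andP[pk /memP[sp p1 _]] ->.
  apply/and3P; split; last by rewrite sumn_full_partition.
    rewrite sorted_pairwise ?pairwise_cat; last exact: geq_trans.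
    rewrite -!sorted_pairwise; try exact: geq_trans.
    apply/and3P; split.
    - apply/allrelP => x y /mapP[q _ ->] /nseqP[-> _] /=; lia.
    - by rewrite sorted_map.
    - by case: (_ - _)%N => //= n; elim: n => //= n ->.
  by rewrite all_cat all_nseq orbT andbT all_map; apply/allP.
move=> /and3P[sr r1 /eqP rk].
have E := filter_ge2_cat sr r1.
have S := sumn_filter_le r1; have L := size_filter_ge2 r1.
exists (map predn (seq.filter (leq 2) r)).
  rewrite mem_filter size_map -[X in (_ <= X)%N]rk L/=.
  apply/flatten_mapP; exists (sumn (map predn (seq.filter (leq 2) r))).
    by rewrite mem_iota/= add0n; case: (r) rk k0 S => [|? ?] /=; lia.
  rewrite mem_partitions; apply/and3P; split => //.
    have := sorted_filter geq_trans (leq 2) sr.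
    by apply: homo_sorted => x y /=; lia.
  by apply/allP => x /mapP[q]; rewrite mem_filter => /andP[] + _ ->;
    case: q => [|[]].
rewrite /full_partition size_map {1}E -map_comp; congr (_ ++ nseq _ _); last by lia.
by rewrite map_id_in// => x; rewrite mem_filter => /andP[] + _; case: x.
Qed.

(** The added ones do not change the product of the parts and contribute the factorial of their
    number; the shift [succn] preserves the other multiplicities. *)
Lemma cycle_weight_full k p : all (leq 1) p ->
  cycle_weight (full_partition k p) = (\prod_(a <- p) a.+1 *
    ((k - sumn p - size p)`! * \prod_(q <- undup p) (count_mem q p)`!))%N.
Proof.
move=> p1; set n := (k - _ - _)%N.
rewrite /cycle_weight {1}/full_partition big_cat/= big_map.
rewrite [X in (_ * X * _)%N]big1_seq ?muln1; last by move=> q /nseqP[].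
congr (_ * _)%N.
have ltK q : q \in p -> (q < (sumn p).+1)%N by rewrite ltnS; exact: mem_le_sumn.
rewrite (@prod_count_fact _ (sumn p).+2); last first.
  move=> q; rewrite mem_cat => /orP[/mapP[r /ltK ? ->]//|/nseqP[-> _]//].
rewrite (prod_count_fact ltK) big_ord_recl/= big_ord_recl/= [in RHS]big_ord_recl/=.
have c0 : count_mem 0%N p = 0%N.
  by apply/count_memPn; apply: contraTN p1 => p0; apply/allPn; exists 0%N.
rewrite /full_partition !count_cat !count_map !count_nseq /= c0 fact0 !mul1n.
have -> : count (preim succn (pred1 0%N)) p = 0%N
  by rewrite (@eq_count _ _ pred0) ?count_pred0.
rewrite add0n mul0n fact0 mul1n add0n; congr (_ * _)%N.
by apply: eq_bigr => i _; rewrite count_cat count_map count_nseq/= addn0.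
Qed.

(** When [sumn p + size p <= k], the coefficient is thus the number of permutations of [k] letters
    of cycle type [full_partition k p]. *)
Lemma dcoefE k p : all (leq 1) p ->
  dcoef F k (sumn p) p = k`!%:R / (cycle_weight (full_partition k p))%:R.
Proof.
move=> p1; rewrite cycle_weight_full// /dcoef -!mulrA; congr (_ * _).
by rewrite !natrM !natr_prod !invfM -!prodfV mulrCA.
Qed.

(** The expansion of $e_k$ reindexed by [full_partition]. The full partition has [k - j] parts, so
    that its sign is $(-1)^j$. *)
Lemma elem_sum_dcoef k Psi : (0 < k)%N -> perm_invariant Psi ->
  elem_sum k Psi = \sum_(j < k) (-1) ^+ j *
    \sum_(n < k.+1) \sum_(p : int_partition k j n)
      dcoef F k j (parts p) / k`!%:R *
      power_sum (map succn (parts p) ++ nseq (k - j - n) 1%N) Psi.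
Proof.
move=> k0 iPsi; rewrite elem_sum_power_sum//.
rewrite -(perm_big _ (full_partition_perm k0))/= big_map big_filter big_flatten/=.
rewrite big_map -{1}[k]subn0 big_mkord; apply: eq_bigr => j _.
pose G (n : nat) p := dcoef F k j p / k`!%:R *
  power_sum (map succn p ++ nseq (k - j - n) 1%N) Psi.
transitivity ((-1) ^+ j * \sum_(n < k.+1)
    \sum_(p <- partitions j | (j + size p <= k)%N && (size p == n)) G n p).
  2: by congr (_ * _); apply: eq_bigr => n _;
    rewrite -(sum_int_partition _ _ _ (G n)).
rewrite (exchange_big_dep (fun p => j + size p <= k)%N)/=; last first.
  by move=> ? ? _ /andP[].
rewrite mulr_sumr big_seq_cond [RHS]big_seq_cond; apply: eq_big => p.
  by rewrite mem_partitions; apply: andb_id2l => /and3P[_ _ /eqP ->].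
rewrite mem_partitions => /andP[/and3P[_ p1 /eqP pj] pk].
have sk : (size p < k.+1)%N by rewrite ltnS (leq_trans (leq_addl _ _) pk).
rewrite (big_pred1 (Ordinal sk)); last first.
  by move=> n; rewrite -pj pk/= eq_sym.
rewrite size_full_partition// pj subKn; last exact: ltnW.
rewrite /G/= -[X in dcoef F k X p]pj dcoefE//.
rewrite [k`!%:R / _]mulrC mulfK ?pnatr_eq0 -?lt0n ?fact_gt0//.
by rewrite mulrA -pj.
Qed.
End expansion.

(** * Integrals against signed measures *)

Lemma addeBB (R : realDomainType) (a b c e : \bar R) : b \is a fin_num ->
  e \is a fin_num ->
  (a + c - (b + e) = a - b + (c - e))%E.
Proof. by move=> bf ef; rewrite fin_num_oppeD// addeACA. Qed.

Lemma muleB_fin (R : realDomainType) (r : R) (a b : \bar R) : a \is a fin_num ->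
  (r%:E * (a - b) = r%:E * a - r%:E * b)%E.
Proof. by move=> af; rewrite muleBr// fin_num_adde_defr. Qed.

Section bounded_integral.
Context d (T : measurableType d) (R : realType).
Implicit Types (mu : {measure set T -> \bar R}) (f : T -> R).

Definition bounded_mfun f : Prop :=
  measurable_fun setT f /\ exists M : R, forall x, `|f x| <= M.

Lemma bounded_mfun_integrable mu f : (mu setT < +oo)%E -> bounded_mfun f ->
  mu.-integrable setT (EFin \o f).
Proof.
move=> muoo [mf [M fM]]; apply: measurable_bounded_integrable => //.
exists M; split; first exact: num_real.
by move=> y My x _ /=; rewrite (le_trans (fM x))// ltW.
Qed.

Lemma bounded_mfun_fin_num mu f : (mu setT < +oo)%E -> bounded_mfun f ->
  (\int[mu]_x (f x)%:E)%E \is a fin_num.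
Proof. by move=> muoo bf; apply: integrable_fin_num => //;
  exact: bounded_mfun_integrable. Qed.

Lemma integral_mscale (r : {nonneg R}) mu f : (mu setT < +oo)%E -> bounded_mfun f ->
  (\int[mscale r mu]_x (f x)%:E = r%:num%:E * \int[mu]_x (f x)%:E)%E.
Proof.
move=> muoo bf; have fi := bounded_mfun_integrable muoo bf.
have mf : measurable_fun setT (fun x => (f x)%:E) := measurable_int _ fi.
rewrite [LHS]integralE (ge0_integral_mscale mu measurableT r (measurable_funepos
  mf))//.
rewrite (ge0_integral_mscale mu measurableT r (measurable_funeneg mf))//.
rewrite [in RHS]integralE [RHS]muleBr//.
apply: fin_num_adde_defl; rewrite fin_numN.
by apply: integrable_fin_num => //; exact: integrable_funeneg.
Qed.

(** Any decomposition into finite measures may replace the Jordan one: [jp + m2] and [m1 + jn] agree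
    on measurable sets, and all four integrals are finite, so the terms can be moved across. *)
Lemma charge_integralE (nu : {charge set T -> \bar R}) (m1 m2 : {measure set T ->
  \bar R}) f :
  (m1 setT < +oo)%E -> (m2 setT < +oo)%E ->
  (forall A, measurable A -> nu A = m1 A - m2 A)%E -> bounded_mfun f ->
  charge_integral nu f = (\int[m1]_x (f x)%:E - \int[m2]_x (f x)%:E)%E.
Proof.
move=> m1oo m2oo nuE bf; rewrite /charge_integral.
set P := cid _; set N := cid _; set jp := jordan_pos _; set jn := jordan_neg _.
have jpoo : (jp setT < +oo)%E by rewrite ltey_eq fin_num_measure.
have jnoo : (jn setT < +oo)%E by rewrite ltey_eq fin_num_measure.
have i1 := bounded_mfun_integrable m1oo bf;
  have i2 := bounded_mfun_integrable m2oo bf.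
have ip := bounded_mfun_integrable jpoo bf;
  have iN := bounded_mfun_integrable jnoo bf.
have fin (mu : {measure set T -> \bar R}) A : (mu setT < +oo)%E ->
  measurable A -> mu A \is a fin_num.
  move=> muoo mA; rewrite ge0_fin_numE// (le_lt_trans _ muoo)// le_measure ?inE//.
have key : (\int[measure_add jp m2]_x (f x)%:E =
  \int[measure_add m1 jn]_x (f x)%:E)%E.
  apply: eq_measure_integral => A mA _; rewrite [LHS]measure_addE [RHS]measure_addE.
  have jd : (jp A - jn A = m1 A - m2 A)%E.
    by rewrite -nuE// (jordan_decomp (svalP N) mA) /cadd/= cscaleN1.
  suff : (jp A + m2 A = m1 A + jn A)%E by [].
  have := And4 (fin _ _ jpoo mA) (fin _ _ jnoo mA) (fin _ _ m1oo mA) (fin _ _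
    m2oo mA).
  move: jd => /[swap].
  case: (jp A) (jn A) (m1 A) (m2 A) => [a||] [b||] [c||] [e||] [] //= _ _ _ _ [].
  by move=> /eqP; rewrite subr_eq addrAC => /eqP ->; rewrite -EFinD subrK.
move: key; rewrite !integral_measure_add//.
have [fp fn f1 f2] : [/\ (\int[jp]_x (f x)%:E)%E \is a fin_num,
  (\int[jn]_x (f x)%:E)%E \is a fin_num, (\int[m1]_x (f x)%:E)%E \is a fin_num &
  (\int[m2]_x (f x)%:E)%E \is a fin_num] by split; apply: bounded_mfun_fin_num.
rewrite -(fineK fp) -(fineK fn) -(fineK f1) -(fineK f2) -!EFinB -!EFinD => -[e].
by congr EFin; apply/eqP; rewrite subr_eq addrAC -e addrK.
Qed.

Lemma charge_integral_fin_num (nu : {charge set T -> \bar R}) f :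
  bounded_mfun f -> charge_integral nu f \is a fin_num.
Proof.
move=> bf; rewrite /charge_integral fin_numB !bounded_mfun_fin_num//.
  by rewrite ltey_eq fin_num_measure.
by rewrite ltey_eq fin_num_measure.
Qed.

Lemma charge_integral_zero f : bounded_mfun f ->
  charge_integral (charge_zero : {charge set T -> \bar R}) f = 0%E.
Proof.
move=> bf; rewrite (@charge_integralE _ mzero mzero)//.
- by rewrite integral_measure_zero subee.
- by rewrite /mzero ltry.
- by rewrite /mzero ltry.
- by move=> A mA; rewrite /mzero sube0.
Qed.

Lemma jordan_measures (nu : {charge set T -> \bar R}) :
  exists m1 m2 : {measure set T -> \bar R},
  [/\ (m1 setT < +oo)%E, (m2 setT < +oo)%E,
    forall A, measurable A -> (nu A = m1 A - m2 A)%E,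
    forall A, measurable A -> m1 A \is a fin_num &
    forall A, measurable A -> m2 A \is a fin_num].
Proof.
have [P [N nuPN]] := Hahn_decomposition nu.
exists (jordan_pos nuPN), (jordan_neg nuPN); split.
- by rewrite ltey_eq fin_num_measure.
- by rewrite ltey_eq fin_num_measure.
- by move=> A mA; rewrite (jordan_decomp nuPN mA) /cadd/= cscaleN1.
- by move=> A mA; rewrite fin_num_measure.
- by move=> A mA; rewrite fin_num_measure.
Qed.

Lemma charge_integral_add (n1 n2 : {charge set T -> \bar R}) f : bounded_mfun f ->
  charge_integral (charge_add n1 n2) f =
  (charge_integral n1 f + charge_integral n2 f)%E.
Proof.
move=> bf.
have [p1 [q1 [p1oo q1oo n1E p1f q1f]]] := jordan_measures n1.
have [p2 [q2 [p2oo q2oo n2E p2f q2f]]] := jordan_measures n2.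
rewrite (charge_integralE p1oo q1oo n1E bf) (charge_integralE p2oo q2oo n2E bf).
have poo : (measure_add p1 p2 setT < +oo)%E by rewrite measure_addE lte_add_pinfty.
have qoo : (measure_add q1 q2 setT < +oo)%E by rewrite measure_addE lte_add_pinfty.
have nE A : measurable A ->
    (charge_add n1 n2 A = measure_add p1 p2 A - measure_add q1 q2 A)%E.
  move=> mA; rewrite [X in (X - _)%E]measure_addE [X in (_ - X)%E]measure_addE.
  by rewrite addeBB ?q1f ?q2f// -n1E// -n2E.
rewrite (charge_integralE poo qoo nE bf).
rewrite !integral_measure_add//; try exact: bounded_mfun_integrable.
by rewrite addeBB//; exact: bounded_mfun_fin_num.
Qed.

Lemma charge_integral_scale r (nu : {charge set T -> \bar R}) f : bounded_mfun f ->
  charge_integral (charge_scale r nu) f = (r%:E * charge_integral nu f)%E.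
Proof.
move=> bf.
have [p [q [poo qoo nE pf qf]]] := jordan_measures nu.
rewrite (charge_integralE poo qoo nE bf).
have [r0|r0] := leP 0 r.
  pose s := NngNum r0.
  have spoo : (mscale s p setT < +oo)%E by rewrite /mscale/= lte_mul_pinfty.
  have sqoo : (mscale s q setT < +oo)%E by rewrite /mscale/= lte_mul_pinfty.
  have sE A : measurable A -> (charge_scale r nu A = mscale s p A - mscale s q A)%E.
    by move=> mA; rewrite /mscale/= /cscale nE// muleB_fin// pf.
  rewrite (charge_integralE spoo sqoo sE bf) !integral_mscale//=.
  by rewrite [RHS]muleB_fin//; exact: bounded_mfun_fin_num.
(* For negative [r] the two measures exchange their roles, with factor [- r]. *)
have r0' : 0 <= - r by rewrite oppr_ge0 ltW.
pose s := NngNum r0'.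
have spoo : (mscale s p setT < +oo)%E by rewrite /mscale/= lte_mul_pinfty.
have sqoo : (mscale s q setT < +oo)%E by rewrite /mscale/= lte_mul_pinfty.
have sE A : measurable A -> (charge_scale r nu A = mscale s q A - mscale s p A)%E.
  move=> mA; rewrite /mscale/= /cscale nE// muleB_fin ?pf//.
  by rewrite EFinN !mulNe oppeK addeC.
rewrite (charge_integralE sqoo spoo sE bf) !integral_mscale//=.
rewrite [RHS]muleB_fin; last exact: bounded_mfun_fin_num.
by rewrite EFinN !mulNe oppeK addeC.
Qed.

Lemma charge_integral_sum (I : Type) (s : seq I) (P : pred I) (nu : I ->
  {charge set T -> \bar R}) f :
  bounded_mfun f ->
  charge_integral (\big[@charge_add _ _ _/charge_zero]_(i <- s | P i) nu i) f =
  (\sum_(i <- s | P i) charge_integral (nu i) f)%E.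
Proof.
move=> bf; elim/big_rec2: _ => [|i x y _ <-]; first exact: charge_integral_zero.
exact: charge_integral_add.
Qed.

End bounded_integral.

(** Pushing both measures of a decomposition forward decomposes the image charge. The result need
    not be its Jordan decomposition, but [charge_integralE] accepts it. *)
Lemma charge_integral_push d d' (T : measurableType d) (T' :
  measurableType d') (R : realType)
    (g : {mfun T >-> T'}) (nu : {charge set T -> \bar R}) (f : T' -> R) :
  bounded_mfun f ->
  charge_integral (charge_push g nu) f = charge_integral nu (f \o g).
Proof.
move=> bf.
have bfg : bounded_mfun (f \o g).
  split; first by apply: measurableT_comp => //; exact: bf.1.
  by have [M fM] := bf.2; exists M => x; exact: fM.
have [p [q [poo qoo nE pf qf]]] := jordan_measures nu.
rewrite (charge_integralE poo qoo nE bfg).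
have mg : measurable_fun setT g by [].
have mf : measurable_fun setT (fun x => (f x)%:E) by apply/measurable_EFinP;
  exact: bf.1.
have E (mu : {measure set T -> \bar R}) : (mu setT < +oo)%E ->
    (\int[pushforward mu g]_x (f x)%:E = \int[mu]_x (f (g x))%:E)%E.
  by move=> muoo; rewrite (integral_pushforward mg mf (bounded_mfun_integrable
    muoo bfg) measurableT).
rewrite -(E p poo) -(E q qoo).
apply: charge_integralE => // A mA.
rewrite -nE//.
by rewrite -[X in measurable X]setTI; exact: mg.
Qed.

Lemma charge_integral_of (R : realType) (T : ptopologicalType) (mu :
  Prob R T) (f : T -> R) :
  bounded_mfun (f : borel T -> R) ->
  charge_integral (charge_of mu) f = (\int[mu]_x (f x)%:E)%E.
Proof.
move=> bf.
rewrite (@charge_integralE _ _ _ _ mu mzero) //.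
- by rewrite integral_measure_zero sube0.
- by rewrite ltey_eq fin_num_measure.
- by rewrite /mzero ltry.
- by move=> A mA; rewrite /mzero sube0.
Qed.

(** * Uniform laws on finite lists *)

(** The points are counted with multiplicity, as in an empirical measure. *)
Definition uniform_on d (T : measurableType d) (R : realType)
    (mu : set T -> \bar R) (s : seq T) : Prop :=
  forall A, measurable A -> mu A = ((size s)%:R^-1%:E * \sum_(y <- s) \d_y A)%E.

Section uniform_on.
Context d (T : measurableType d) (R : realType).
Implicit Types (mu : {measure set T -> \bar R}) (s : seq T).

Lemma uniform_on_ge0_integral mu s (f : T -> \bar R) : uniform_on mu s ->
  measurable_fun setT f -> (forall x, 0 <= f x)%E ->
  (\int[mu]_x f x = (size s)%:R^-1%:E * \sum_(y <- s) f y)%E.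
Proof.
move=> mus mf f0.
have r0 : 0 <= ((size s)%:R^-1 : R) by rewrite invr_ge0.
pose D (i : nat) : {measure set T -> \bar R} := dirac (nth point s i).
transitivity (\int[mscale (NngNum r0) (msum D (size s))]_x f x)%E.
  apply: eq_measure_integral => A mA _; rewrite [LHS]mus// /mscale/= /msum.
  by rewrite (big_nth point) big_mkord.
rewrite ge0_integral_mscale// ge0_integral_measure_sum//=.
rewrite (big_nth point) big_mkord; congr (_ * _)%E.
by apply: eq_bigr => i _; rewrite integral_dirac// diracT mul1e.
Qed.

Lemma uniform_on_integral mu s (f : T -> R) : uniform_on mu s ->
  bounded_mfun f ->
  (\int[mu]_x (f x)%:E)%E = ((size s)%:R^-1 * \sum_(y <- s) f y)%:E.
Proof.
move=> mus [mf [M fM]].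
pose g x : R := Num.max (f x) 0; pose h x : R := Num.max (- f x) 0.
have mg : measurable_fun setT (fun x => (g x)%:E).
  by apply/measurable_EFinP; exact: measurable_maxr.
have mh : measurable_fun setT (fun x => (h x)%:E).
  by apply/measurable_EFinP; apply: measurable_maxr => //; exact: measurableT_comp.
rewrite integralE.
rewrite (_ : (fun x => (f x)%:E)^\+%E = fun x => (g x)%:E); last first.
  by apply/funext => x; rewrite funeposE /g EFin_max.
rewrite (_ : (fun x => (f x)%:E)^\-%E = fun x => (h x)%:E); last first.
  by apply/funext => x; rewrite funenegE /h EFin_max.
rewrite (uniform_on_ge0_integral mus mg); last by move=> x;
  rewrite lee_fin le_max lexx orbT.
rewrite (uniform_on_ge0_integral mus mh); last by move=> x;
  rewrite lee_fin le_max lexx orbT.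
rewrite !sumEFin -!EFinM -EFinB -mulrBr -sumrB; congr ((_ * _)%:E).
apply: eq_bigr => y _; rewrite /g /h.
case/orP: (le_total 0 (f y)) => f0.
  by rewrite max_l// max_r ?subr0// oppr_le0.
by rewrite max_r// max_l ?sub0r ?opprK// oppr_ge0.
Qed.

End uniform_on.

Lemma uniform_on_pushforward d d' (T : measurableType d) (T' :
  measurableType d') (R : realType)
    (mu : set T -> \bar R) (s : seq T) (f : T -> T') :
  measurable_fun setT f -> uniform_on mu s ->
    uniform_on (pushforward mu f) (map f s).
Proof.
move=> mf mus A mA; rewrite /pushforward mus; last first.
  by rewrite -[X in measurable X]setTI; exact: mf.
by rewrite size_map big_map.
Qed.

(** * Words of repeated letters and the uniform laws on them *)

Section words.
Context (T : eqType).
Implicit Types (x : seq T) (r : seq nat).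

(** The monomials, with repetitions, of the product of the power sums $p_q$, [q] in [r], in the
    letters of [x]. *)
Fixpoint words x r : seq (seq T) :=
  if r is q :: r' then [seq nseq q a ++ l | a <- x, l <- words x r']
  else [:: [::]].

Lemma size_words x r : size (words x r) = (size x ^ size r)%N.
Proof. by elim: r => //= q r IH; rewrite size_allpairs IH expnS. Qed.

Lemma words_cat x r r' :
  words x (r ++ r') = [seq l ++ l' | l <- words x r, l' <- words x r'].
Proof.
elim: r => [|q r IH] /=; first by rewrite cats0 map_id.
rewrite IH; elim: x {IH} (words x r) (words x r') => //= a x IHx w w'.
rewrite IHx [in RHS]map_cat flatten_cat; congr (_ ++ _).
elim: w {IHx} => //= l w <-; rewrite map_cat -map_comp; congr (_ ++ _).
by apply: eq_map => l' /=; rewrite catA.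
Qed.

End words.

Lemma power_sum_words (F : comPzRingType) (I : finType) (T : eqType) (x : I -> T) r
    (Psi : seq T -> F) :
  power_sum r (fun l : seq I => Psi (map x l)) =
  \sum_(l <- words (map x (enum I)) r) Psi l.
Proof.
elim: r Psi => [|q r IH] Psi /=; first by rewrite big_seq1.
rewrite big_allpairs_dep/= big_map big_enum/=; apply: eq_bigr => a _.
rewrite -(IH (fun l => Psi (nseq q (x a) ++ l))).
by apply: power_sum_ext => l; rewrite map_cat map_nseq.
Qed.

Definition pow_list (T : Type) n (y : pow T n) :
  seq T := [seq y i | i <- enum 'I_n].

Lemma size_pow_list (T : Type) n (y : pow T n) : size (pow_list y) = n.
Proof. by rewrite size_map size_enum_ord. Qed.

Lemma nth_pow_list (T : Type) n (y : pow T n) t (i : 'I_n) :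
  nth t (pow_list y) i = y i.
Proof. by rewrite (nth_map i) ?size_enum_ord// nth_ord_enum. Qed.

Lemma pow_list_diag (T : Type) n (a : T) : pow_list (@diag T n a) = nseq n a.
Proof. by rewrite -[in RHS](size_enum_ord n); rewrite /pow_list;
  elim: (enum _) => //= i s ->. Qed.

Section word_law.
Context (R : realType) (X : polishType R).

Lemma pow_list_cat m n (z : pow X m * pow X n) :
  pow_list (pow_cat z) = pow_list z.1 ++ pow_list z.2.
Proof.
apply: (@eq_from_nth _ point); first by rewrite size_cat !size_pow_list.
rewrite size_pow_list => i imn.
rewrite -[i]/(nat_of_ord (Ordinal imn)) nth_pow_list nth_cat size_pow_list /pow_cat.
case: split_ordP => j /(congr1 val)/= ->.
  by rewrite nth_pow_list.
by rewrite addKn nth_pow_list.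
Qed.

(* [mu] is uniform on points of X^n listing the words formed of letters of [x]
   repeated according to [r]. *)
Definition word_law n (mu : Prob R (pow X n)) (x : seq X) (r : seq nat) : Prop :=
  exists2 s : seq (pow X n), uniform_on mu (s : seq (borel (pow X n))) &
    map (@pow_list X n) s = words x r.

Lemma word_law0 x : word_law (prob_pow0 X) x [::].
Proof.
exists [:: point] => /=.
  by move=> A mA; rewrite big_seq1 invr1 mul1e.
by congr [:: _]; apply: size0nil; rewrite size_pow_list.
Qed.

Lemma word_law_diag (lambda : Prob R X) (x : seq X) q :
  uniform_on lambda (x : seq (borel X)) -> word_law (prob_diag q lambda) x [:: q].
Proof.
move=> lx; exists (map (@diag X q) x).
  exact: (uniform_on_pushforward (continuous_borel (@continuous_diag X q)) lx).
rewrite -map_comp /=; elim: x {lx} => //= a x <-.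
by rewrite pow_list_diag cats0.
Qed.

(** The product of two uniform laws is uniform on the concatenated pairs, and these spell the words
    of [r ++ r'] by [words_cat]. *)
Lemma word_law_prod m n (mu : Prob R (pow X m)) (nu : Prob R (pow X n)) x r r' :
  word_law mu x r -> word_law nu x r' -> word_law (prob_prod mu nu) x (r ++ r').
Proof.
move=> [s mus sE] [t nut tE].
exists [seq pow_cat (y, z) | y <- s, z <- t]; last first.
  rewrite words_cat -sE -tE; elim: s {mus sE} => //= y s IH.
  rewrite map_cat IH; congr (_ ++ _); rewrite -!map_comp; apply: eq_map => z /=.
  by rewrite pow_list_cat.
move=> A mA.
have mB : measurable ((@pow_cat R X m n : borel (pow X m) * borel (pow X n) ->
  borel (pow X (m + n))) @^-1` A).
  by rewrite -[X in measurable X]setTI; exact: measurable_pow_cat.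
rewrite /prob_prod /=.
(* The product measure is by definition the integral of the masses of the sections. *)
transitivity (\int[mu]_y nu (xsection ((@pow_cat R X m n) @^-1` A) y))%E;
  first by [].
rewrite (uniform_on_ge0_integral mus) //; last exact: measurable_fun_xsection.
transitivity (((size s)%:R^-1 : R)%:E * \sum_(y <- s) (((size t)%:R^-1 : R)%:E *
    \sum_(z <- t) \d_(z : borel (pow X n)) (xsection ((@pow_cat R X m n) @^-1` A)
      y : set (borel (pow X n)))))%E.
  congr (_ * _)%E; apply: eq_bigr => y _; apply: nut.
  exact: (@measurable_xsection _ _ (borel (pow X m)) (borel (pow X n)) _ _ mB).
rewrite size_allpairs big_allpairs_dep/= natrM invfM EFinM -muleA; congr (_ * _)%E.
rewrite ge0_sume_distrr; last by move=> y _; exact: sume_ge0.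
apply: eq_bigr => y _; congr (_ * _)%E; apply: eq_bigr => z _.
by rewrite !diracE; congr ((_ : bool)%:R%:E); apply/idP/idP;
  rewrite !inE /xsection/= ?inE.
Qed.

Lemma word_law_cast m n (e : m = n) (mu : Prob R (pow X m)) x r :
  word_law mu x r -> word_law (prob_cast e mu) x r.
Proof. by case: n / e. Qed.

Lemma word_law_pow (lambda : Prob R X) (x : seq X) n :
  uniform_on lambda (x : seq (borel X)) ->
    word_law (prob_pow lambda n) x (nseq n 1%N).
Proof.
move=> lx; elim: n => [|n IH] /=; first exact: word_law0.
by apply: (@word_law_prod 1 n _ _ _ [:: 1%N]) => //; exact: word_law_diag.
Qed.

Lemma word_law_blocks (lambda : Prob R X) (x : seq X) p :
  uniform_on lambda (x : seq (borel X)) ->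
  word_law (prob_blocks lambda p) x (map succn p).
Proof.
move=> lx; elim: p => [|q p IH] /=; first exact: word_law0.
by apply: (@word_law_prod q.+1 _ _ _ _ [:: q.+1]) => //; exact: word_law_diag.
Qed.

(* The value 0 at lists of the wrong length makes [list_fun Phi] invariant under
   permutations of lists of all lengths. *)
Definition list_fun n (Phi : pow X n -> R) (l : seq X) : R :=
  if size l == n then Phi (fun i => nth point l i) else 0.

Lemma list_fun_pow_list n (Phi : pow X n ->
  R) y : list_fun Phi (pow_list y) = Phi y.
Proof.
rewrite /list_fun size_pow_list eqxx.
by congr Phi; apply/funext => i; rewrite nth_pow_list.
Qed.

Lemma word_law_integral n (mu : Prob R (pow X n)) x r (Phi : pow X n -> R) :
  bounded_mfun (Phi : borel (pow X n) -> R) -> word_law mu x r ->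
  (\int[mu]_y (Phi y)%:E = ((size x)%:R ^- size r * \sum_(l <- words x r)
    list_fun Phi l)%:E)%E.
Proof.
move=> bPhi [s mus sE]; rewrite (uniform_on_integral mus bPhi).
rewrite -natrX -size_words -sE size_map big_map.
by under [in RHS]eq_bigr do rewrite list_fun_pow_list.
Qed.

End word_law.

(** * The integral of F_{N,k} at an empirical measure *)

Lemma sorted_enum_set N (A : {set 'I_N}) : sorted ltn (map val (enum A)).
Proof.
apply: (@subseq_sorted _ ltn ltn_trans _ (map val (enum 'I_N))).
  by apply: map_subseq; rewrite {1}/enum_mem -enumT; exact: filter_subseq.
by rewrite val_enum_ord iota_ltn_sorted.
Qed.

(** An increasing map is determined by its image, since [enum] lists a set of ordinals in increasing
    order. The default [N0] of [nth] is never reached when [A] has [k] elements. *)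
Lemma sum_increasing (V : nmodType) N k (N0 : 'I_N) (G : {ffun 'I_k -> 'I_N} -> V) :
  \sum_(s : {ffun 'I_k -> 'I_N} | increasing s) G s =
  \sum_(A : {set 'I_N} | #|A| == k) G [ffun i : 'I_k => nth N0 (enum A) i].
Proof.
pose h (A : {set 'I_N}) := [ffun i : 'I_k => nth N0 (enum A) i].
pose h' (s : {ffun 'I_k -> 'I_N}) := [set s i | i : 'I_k].
have incP (s : {ffun 'I_k -> 'I_N}) : increasing s ->
    forall a b : 'I_k, (a < b)%N -> (s a < s b)%N.
  by move=> /forallP h1 a b; have /forallP/(_ b)/implyP := h1 a.
have inc_inj (s : {ffun 'I_k -> 'I_N}) : increasing s -> injective s.
  move=> /incP si a b sab; apply/val_inj => /=.
  by have [/si|/si|//] := ltngtP a b; rewrite sab ltnn.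
rewrite (reindex_onto h h') /=; last first.
  move=> s si.
  have E : enum (h' s) = [seq s i | i <- enum 'I_k].
    apply: (inj_map val_inj); apply: (irr_sorted_eq ltn_trans ltnn).
    - exact: sorted_enum_set.
    - rewrite -map_comp; have : sorted ltn (map val (enum 'I_k)).
        by rewrite val_enum_ord iota_ltn_sorted.
      rewrite !sorted_map; apply: sub_sorted => a b; exact: incP.
    - move=> n; apply/mapP/mapP => -[a aA ->]; exists a => //.
        move: aA; rewrite mem_enum => /imsetP[i _ ->].
        by apply/mapP; exists i; rewrite ?mem_enum.
      by move: aA => /mapP[i _ ->]; rewrite mem_enum; exact: imset_f.
  apply/ffunP => i; rewrite ffunE E (nth_map i) ?size_enum_ord//.
  by rewrite nth_ord_enum.
apply: eq_bigl => A; apply/andP/idP => [[hi /eqP <-]|/eqP Ak].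
  by rewrite card_imset ?card_ord//; exact: inc_inj.
have szA : size (enum A) = k by rewrite -cardE.
split.
  apply/forallP => a; apply/forallP => b; apply/implyP => ab; rewrite !ffunE.
  have := sorted_enum_set A.
  move=> /(sorted_ltn_nth ltn_trans 0%N)/(_ a b).
  rewrite !inE !size_map szA !ltn_ord => /(_ isT isT ab).
  by rewrite !(nth_map N0) ?szA.
apply/eqP/setP => a; apply/imsetP/idP => [[i _ ->]|aA].
  by rewrite ffunE -mem_enum mem_nth// szA.
have ia : (index a (enum A) < k)%N by rewrite -szA index_mem mem_enum.
by exists (Ordinal ia) => //; rewrite ffunE/= nth_index// mem_enum.
Qed.

Section integral_FNk.
Context (R : realType) (X : polishType R).

Lemma list_fun_perm k (Phi : pow X k -> R) (s t : seq X) : symmetric_fun Phi ->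
  perm_eq s t -> list_fun Phi s = list_fun Phi t.
Proof.
move=> sPhi st; rewrite /list_fun (perm_size st); case: eqP => // tk.
have ss : size s == k by rewrite (perm_size st) tk.
have ts : size t == k by apply/eqP.
have /tuple_permP[p sE] : perm_eq (Tuple ss) (Tuple ts) by [].
have {}sE : s = [tuple tnth (Tuple ts) (p i) | i < k] := sE.
rewrite -[RHS](sPhi p); congr Phi; apply/funext => i; rewrite /Defs.reindex sE.
rewrite -[LHS](tnth_nth point [tuple tnth (Tuple ts) (p i) | i < k]).
by rewrite tnth_mktuple (tnth_nth point).
Qed.

Lemma cost_elem_sum N k (Phi : pow X k -> R) (x : pow X N) : (0 < N)%N ->
  cost Phi x = ('C(N, k)%:R)^-1 *
    elem_sum k (fun l : seq 'I_N => list_fun Phi (map x l)).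
Proof.
move=> N0; rewrite /cost; congr (_ * _).
rewrite (sum_increasing (Ordinal N0) (fun s => Phi (Defs.reindex s x))).
apply: eq_bigr => A /eqP Ak; rewrite /list_fun size_map -cardE Ak eqxx.
congr Phi; apply/funext => i; rewrite /Defs.reindex ffunE (nth_map (Ordinal N0))//.
by rewrite -cardE Ak.
Qed.

(** A symmetric [Phi] has the same integral against each of the [k!] permuted charges. *)
Lemma charge_integral_sym k (nu : {charge set (borel (pow X k)) ->
  \bar R}) (Phi : pow X k -> R) :
  bounded_mfun (Phi : borel (pow X k) -> R) -> symmetric_fun Phi ->
  charge_integral (charge_sym nu) Phi = charge_integral nu Phi.
Proof.
move=> bPhi sPhi; rewrite /charge_sym charge_integral_scale// charge_integral_sum//.
under eq_bigr => s _.
  rewrite /charge_perm charge_integral_push//.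
  rewrite (_ : _ \o _ = Phi); last by apply/funext => x; exact: sPhi.
  over.
rewrite -(fineK (charge_integral_fin_num nu bPhi)) sumEFin -EFinM sumr_const.
rewrite card_Sn -[X in _ * X]mulr_natl mulrA mulVf ?mul1r//.
Qed.

(** The measure attached to [p] is uniform on words with $n + (k-j-n) = k-j$ freely chosen letters,
    whence the common factor $N^{-(k-j)}$. *)
Lemma charge_integral_Pj k j (lambda : Prob R X) (N : nat) (x : pow X N) (Phi :
  pow X k -> R) :
  bounded_mfun (Phi : borel (pow X k) -> R) ->
  uniform_on lambda ([seq x i | i <- enum 'I_N] : seq (borel X)) ->
  charge_integral (Pj k j lambda) Phi =
  (N%:R ^- (k - j) * \sum_(n < k.+1) \sum_(p : int_partition k j n)
    dcoef R k j (parts p) * power_sum (map succn (parts p) ++ nseq (k - j - n) 1%N)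
      (fun l : seq 'I_N => list_fun Phi (map x l)))%:E.
Proof.
move=> bPhi lx; rewrite /Pj charge_integral_sum// mulr_sumr -sumEFin.
apply: eq_bigr => n _; rewrite charge_integral_sum// mulr_sumr -sumEFin.
apply: eq_bigr => p _; rewrite charge_integral_scale// charge_integral_of//.
have L : word_law (prob_cast (sumn_parts p)
    (prob_prod (prob_blocks lambda (parts p)) (prob_pow lambda (k - j - n))))
    [seq x i | i <- enum 'I_N] (map succn (parts p) ++ nseq (k - j - n) 1%N).
  apply: word_law_cast; apply: word_law_prod.
    exact: word_law_blocks.
  exact: word_law_pow.
rewrite (word_law_integral bPhi L) -EFinM power_sum_words mulrCA.
congr ((_ ^- _ * _)%:E).
  by rewrite size_map size_enum_ord.
have /andP[_ jnk] := valP p.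
rewrite size_cat size_map size_nseq /parts size_map size_tuple.
by rewrite subnKC// leq_subRL// (leq_trans _ jnk)// leq_addr.
Qed.

(** Both sides become combinations of the same power sums [S j]; it remains to match the normalising
    constants. *)
Lemma charge_integral_FNk k N (lambda : Prob R X) (x : pow X N) (Phi : pow X k ->
  R) :
  (2 <= k)%N -> (k <= N)%N ->
  bounded_mfun (Phi : borel (pow X k) -> R) -> symmetric_fun Phi ->
  uniform_on lambda ([seq x i | i <- enum 'I_N] : seq (borel X)) ->
  charge_integral (FNk N k lambda) Phi = (cost Phi x)%:E.
Proof.
move=> k2 kN bPhi sPhi lx; have k0 : (0 < k)%N by exact: ltnW.
have N0 : (0 < N)%N by exact: leq_trans kN.
pose Psi l := list_fun Phi (map x l).
have iPsi : perm_invariant Psi by move=> s t st; apply: list_fun_perm => //;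
  exact: perm_map.
rewrite cost_elem_sum// elem_sum_dcoef//.
rewrite /FNk charge_integral_scale// charge_integral_add// charge_integral_of//.
rewrite (word_law_integral bPhi (word_law_pow k lx)) charge_integral_sum//.
pose S j : R := \sum_(n < k.+1) \sum_(p : int_partition k j n)
    dcoef R k j (parts p) * power_sum (map succn (parts p) ++ nseq (k - j - n)
      1%N) Psi.
rewrite [X in (_ * (_ + X))%E](eq_bigr (fun j =>
    ((-1) ^+ j / N%:R ^+ j * (N%:R ^- (k - j) * S j))%:E)); last first.
  move=> j _; rewrite charge_integral_scale// charge_integral_sym//.
  by rewrite (charge_integral_Pj _ bPhi lx).
rewrite sumEFin -EFinD -EFinM; congr (_%:E).
(* The leading term $\lambda^{\otimes k}$ is the missing term [j = 0]: its only partition is empty,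
   with coefficient 1. *)
have S0 : power_sum (nseq k 1%N) Psi = S 0%N.
  rewrite /S (bigD1 ord0)//= [X in _ + X]big1 ?addr0 => [|n n0].
    rewrite (sum_int_partition k 0 0 (fun p => dcoef R k 0 p *
      power_sum (map succn p ++ nseq (k - 0 - 0) 1%N) Psi)).
    rewrite (perm_big _ partitions0)/= big_mkcond big_seq1/= !subn0.
    by rewrite /dcoef/= !big_nil !subn0 !mulr1 divff ?mul1r// pnatr_eq0 -lt0n
      fact_gt0.
  rewrite (sum_int_partition k 0 n (fun p => dcoef R k 0 p *
      power_sum (map succn p ++ nseq (k - 0 - n) 1%N) Psi)).
  rewrite (perm_big _ partitions0)/= big_mkcond big_seq1/=.
  by rewrite [0%N == n](negbTE _) ?andbF// eq_sym.
have NR : N%:R != 0 :> R by rewrite pnatr_eq0 -lt0n.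
have -> : (size [seq x i | i <- enum 'I_N])%:R ^- size (nseq k 1%N) *
    \sum_(l <- words [seq x i | i <- enum 'I_N] (nseq k 1%N)) list_fun Phi l =
    (-1) ^+ 0 * (N%:R ^- k * S 0%N) :> R.
  by rewrite size_map size_enum_ord size_nseq -power_sum_words S0 mul1r.
have kpred : (k = k.-1.+1)%N by rewrite prednK.
(* For every [j] the powers $N^{-j}$ and $N^{-(k-j)}$ combine to $N^{-k}$. *)
transitivity ((N%:R ^+ k.-1 / \prod_(1 <= i < k) (N%:R - i%:R)) *
    \sum_(0 <= j < k) (-1) ^+ j * (N%:R ^- k * S j)).
  congr (_ * _); rewrite [in RHS]big_ltn//; congr (_ + _).
  rewrite !big_seq; apply: eq_bigr => j; rewrite mem_index_iota => /andP[_ jk].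
  rewrite -mulrA; congr (_ * _); rewrite mulrA -invfM -exprD subnKC//.
  exact: ltnW.
(* The falling factorial $\binom Nk k!$ also has the factor [i = 0], which is [N]. *)
have -> : \prod_(1 <= i < k) (N%:R - i%:R) = 'C(N, k)%:R * k`!%:R / N%:R :> R.
  rewrite -natrM bin_ffact ffact_prod -(big_mkord xpredT (fun i =>
    N - i)%N) [in RHS]big_ltn// subn0.
  rewrite natrM mulrAC divff// mul1r natr_prod !big_seq; apply: eq_bigr => i.
  rewrite mem_index_iota => /andP[_ ik]; rewrite natrB//.
  by rewrite ltnW// (leq_trans ik).
rewrite big_mkord !mulr_sumr; apply: eq_bigr => j _.
have -> : \sum_(n < k.+1) \sum_(p : int_partition k j n)
   dcoef R k j (parts p) / k`!%:R *
   power_sum (map succn (parts p) ++ nseq (k - j - n) 1%N) Psi = k`!%:R^-1 * S j.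
  rewrite /S mulr_sumr; apply: eq_bigr => n _; rewrite mulr_sumr;
    apply: eq_bigr => p _.
  by rewrite mulrA [_^-1 * _]mulrC.
rewrite invf_div invfM [in N%:R ^- k]kpred exprS invfM.
have Nk : N%:R ^+ k.-1 != 0 :> R by rewrite expf_neq0.
have Ck : 'C(N, k)%:R != 0 :> R by rewrite pnatr_eq0 -lt0n bin_gt0.
have kf : k`!%:R != 0 :> R by rewrite pnatr_eq0 -lt0n fact_gt0.
field.
by rewrite NR Nk Ck kf.
Qed.

End integral_FNk.

(** * Borel measurability *)

Section borel.
Context (R : realType).

Lemma continuous_borel_measurable (T : ptopologicalType) (f : T -> R) :
  continuous f -> measurable_fun [set: borel T] (f : borel T -> R).
Proof.
move=> /continuousP cf; apply: (measurability _ (RGenOpens.measurableE R)).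
move=> _ [_ [a [b ->] <-]]; rewrite setTI; apply: sub_sigma_algebra.
exact/cf/interval_open.
Qed.

Lemma bounded_continuous_mfun (T : ptopologicalType) (f : T -> R) :
  bounded_continuous f -> bounded_mfun (f : borel T -> R).
Proof. by move=> [cf bf]; split => //; exact: continuous_borel_measurable. Qed.

End borel.

(** * Approximation of open sets by continuous functions *)

Section approximation.
Context (R : realType) (X : polishType R).

(** Let [f] be the distance to the complement of [B], capped at 1. It is 1-Lipschitz and positive
    exactly on [B], so $\min(1, n f)$ converges to the indicator. *)
Lemma open_approx (B : set X) : open B -> exists phi : nat -> X -> R,
  [/\ forall n, continuous (phi n), forall n x, 0 <= phi n x <= 1 &
      forall x, phi ^~ x @ \oo --> (\1_B x : R)].
Proof.
move=> oB; have [d [[d0 deq dsym dtri] dnbhs _]] := @polish_completely_metrizable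
  R X.
(* The element 1 keeps the set nonempty when [B] is the whole space. *)
pose S x := [set d x y | y in ~` B] `|` [set 1].
pose f x := inf (S x).
have S0 x v : S x v -> 0 <= v by move=> [[y _ <-]|->].
have Sinf x : has_inf (S x).
  by split; [exists 1; right|exists 0 => v; exact: S0].
have f0 x : 0 <= f x by apply: lb_le_inf; [exact: (Sinf x).1|exact: S0].
have f1 x : f x <= 1 by apply: ge_inf; [exact: (Sinf x).2|right].
have lip x z : f x <= d x z + f z.
  rewrite addrC -lerBlDr; apply: lb_le_inf; first exact: (Sinf z).1.
  move=> v [[y By <-]|->]; rewrite lerBlDr.
    rewrite (le_trans _ (_ : d x y <= _)) //; last by rewrite addrC.
    by apply: ge_inf; [exact: (Sinf x).2|left; exists y].
  by rewrite (le_trans (f1 x))// lerDl.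
have cf : continuous f.
  move=> x; apply/cvgrPdist_lt => e e0.
  apply/dnbhs; exists e => // z /= xz.
  rewrite ltr_distl ltrBlDr (le_lt_trans (lip z x)) ?(le_lt_trans (lip x z))//.
    by rewrite addrC ltrD2l.
  by rewrite addrC ltrD2l dsym.
have fB x : ~ B x -> f x = 0.
  move=> Bx; apply/eqP; rewrite eq_le f0 andbT; apply: ge_inf;
    first exact: (Sinf x).2.
  by left; exists x => //; exact/deq.
have fpos x : B x -> 0 < f x.
  move=> Bx; have /dnbhs[e e0 eB] : nbhs x B by exact: open_nbhs_nbhs.
  apply: (@lt_le_trans _ _ (Num.min e 1)); first by rewrite lt_min e0/=.
  apply: lb_le_inf; first exact: (Sinf x).1.
  move=> v [[y By <-]|->]; last by rewrite ge_min lexx orbT.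
  by rewrite ge_min; apply/orP; left; rewrite leNgt; apply/negP => /eB.
exists (fun n x => Num.min 1 (n%:R * f x)); split.
- move=> n x; apply: (@continuous_min R X (cst 1) (fun x => n%:R * f x)).
    exact: cst_continuous.
  by apply: cvgM; [exact: cvg_cst|exact: cf].
- by move=> n x; rewrite le_min ler01 mulr_ge0//= ge_min lexx.
- move=> x; rewrite indicE; have [Bx|Bx] := boolP (x \in B).
    rewrite inE in Bx; have fx := fpos _ Bx.
    apply: cvg_near_cst; near=> n; apply/min_idPl.
    rewrite -ler_pdivrMr//.
    near: n; exact: nbhs_infty_ger.
  rewrite (_ : (fun n => _) = cst 0); first exact: cvg_cst.
  apply/funext => n; rewrite fB ?mulr0; last by move=> Bx'; rewrite mem_set in Bx.
  by rewrite min_r.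
Unshelve. all: by end_near.
Qed.

Lemma cvg_open_approx (m : Prob R X) (A : set X) (phi : nat -> X -> R) : open A ->
  (forall n, continuous (phi n)) -> (forall n x, 0 <= phi n x <= 1) ->
  (forall x, phi ^~ x @ \oo --> (\1_A x : R)) ->
  (fun n => \int[m]_x (phi n x)%:E)%E @ \oo --> m A.
Proof.
move=> oA cphi phi01 phiA.
have -> : m A = (\int[m]_x (\1_A x)%:E)%E.
  by rewrite integral_indic ?setIT//; exact: sub_sigma_algebra.
have [|||||_ _] := @dominated_convergence _ (borel X) R m setT measurableT (fun n
  x => (phi n x)%:E) (fun x => (\1_A x)%:E) (cst 1%E).
+ by move=> n; apply/measurable_EFinP; exact: continuous_borel_measurable.
+ apply/measurable_EFinP; apply: measurable_indic; exact: sub_sigma_algebra.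
+ apply: aeW => x _; apply/cvg_EFin; first by near=> n.
  exact: phiA.
+ by apply: finite_measure_integrable_cst.
+ apply: aeW => x n _ /=; rewrite lee_fin ger0_norm; by have /andP[] := phi01 n x.
by [].
Unshelve. all: by end_near.
Qed.

(** Approximation from below gives equality on open sets, a generating class stable under
    intersection. *)
Lemma eq_prob_borel (mu nu : Prob R X) :
  (forall phi : X -> R, bounded_continuous phi ->
     \int[mu]_x (phi x)%:E = \int[nu]_x (phi x)%:E)%E ->
  forall A : set (borel X), measurable A -> mu A = nu A.
Proof.
move=> munu; apply: (@g_sigma_algebra_measure_unique _ R (borel X) (@open X) _
  (fun=> setT)).
- by move=> A oA; exact: sub_sigma_algebra.
- by move=> _; exact: openT.
- by rewrite bigcup_const.
- exact: openI.
- move=> A oA; have [phi [cphi phi01 phiA]] := open_approx oA.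
  have key (m : Prob R X) := @cvg_open_approx m _ _ oA cphi phi01 phiA.
  have E : (fun n => \int[mu]_x (phi n x)%:E)%E = (fun n =>
    \int[nu]_x (phi n x)%:E)%E.
    apply/funext => n; apply: munu; split; [exact: cphi|exists 1 => x].
    by have /andP[p0 p1] := phi01 n x; rewrite ger0_norm.
  have := key mu; rewrite E => kmu; exact: (cvg_unique _ kmu (key nu)).
- by move=> _; rewrite ltey_eq fin_num_measure.
Qed.

End approximation.

(** * Probabilities depending measurably on a parameter *)

Definition measurable_family d (S : measurableType d) (R : realType)
    (T : ptopologicalType) (mu : S -> Prob R T) : Prop :=
  forall B : set (borel T), measurable B -> measurable_fun setT (fun s => mu s B).

Section measurable_family.
Context d (S : measurableType d) (R : realType).

(** The measure is unchanged; only the structure on the space of measures passes from the narrow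
    topology to the Giry sigma-algebra. *)
Definition to_giry (T : ptopologicalType) (mu : Prob R T) : giry (borel T) R :=
  (mu : probability (borel T) R).

Lemma measurable_to_giry (T : ptopologicalType) (mu : S -> Prob R T) :
  measurable_family mu -> measurable_fun setT (fun s => to_giry (mu s)).
Proof. by move=> mmu; apply: measurable_giry_codensity => // B mB; exact: mmu. Qed.

Lemma measurable_integral (T : ptopologicalType) (mu : S -> Prob R T) (f : T -> R) :
  measurable_family mu -> bounded_mfun (f : borel T -> R) ->
  measurable_fun setT (fun s => \int[mu s]_x (f x)%:E)%E.
Proof.
move=> mmu [mf _].
have mf' : measurable_fun [set: borel T] (fun x => (f x)%:E)
  by exact/measurable_EFinP.
under eq_fun => s do rewrite integralE.
apply: emeasurable_funB.
  apply: (@measurableT_comp _ _ _ _ _ _ (fun m : giry (borel T) R =>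
    giry_int m (fun x : borel T => (f x)%:E)^\+%E));
      last exact: measurable_to_giry mmu.
  by apply: measurable_giry_int => //; exact: measurable_funepos.
apply: (@measurableT_comp _ _ _ _ _ _ (fun m : giry (borel T) R =>
  giry_int m (fun x : borel T => (f x)%:E)^\-%E));
    last exact: measurable_to_giry mmu.
by apply: measurable_giry_int => //; exact: measurable_funeneg.
Qed.

Lemma measurable_family_push (T T' : ptopologicalType) (f : T ->
  T') (cf : continuous f)
    (mu : S -> Prob R T) :
  measurable_family mu -> measurable_family (fun s => push cf (mu s)).
Proof.
move=> mmu B mB; apply: mmu; rewrite -[X in measurable X]setTI.
exact: continuous_borel.
Qed.

Context (X : polishType R).

(** The product is measurable as a map of Giry spaces, and so is evaluation at the preimage [C] of
    [B] under concatenation. *)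
Lemma measurable_family_prod m n (mu : S -> Prob R (pow X m)) (nu : S ->
  Prob R (pow X n)) :
  measurable_family mu -> measurable_family nu ->
  measurable_family (fun s => prob_prod (mu s) (nu s)).
Proof.
move=> mmu mnu B mB.
pose C : set (borel (pow X m) * borel (pow X n)) := @pow_cat R X m n @^-1` B.
have mC : measurable C.
  by rewrite -[X in measurable X]setTI; exact: measurable_pow_cat.
pose P s : giry (borel (pow X m)) R * giry (borel (pow X n)) R :=
  (to_giry (mu s), to_giry (nu s)).
have mP : measurable_fun setT P.
  by apply: measurable_fun_pair; exact: measurable_to_giry.
have mE : measurable_fun setT (fun p :
  giry (borel (pow X m)) R * giry (borel (pow X n)) R =>
    giry_ev (giry_prod p) C).
  apply: (@measurableT_comp _ _ _ _ _ _ (fun m => giry_ev m C)) => //.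
    exact: measurable_giry_ev.
  exact: measurable_giry_prod.
exact: (measurableT_comp mE mP).
Qed.

Lemma measurable_family_cast m n (e : m = n) (mu : S -> Prob R (pow X m)) :
  measurable_family mu -> measurable_family (fun s => prob_cast e (mu s)).
Proof. by case: n / e. Qed.

Lemma measurable_family_pow (lambda : S -> Prob R X) n :
  measurable_family lambda -> measurable_family (fun s => prob_pow (lambda s) n).
Proof.
move=> ml; elim: n => [|n IH] /=; first by move=> B mB; exact: measurable_cst.
apply: (@measurable_family_prod 1 n (fun s => prob_diag 1 (lambda s))
  (fun s => prob_pow (lambda s) n)) => //.
exact: measurable_family_push.
Qed.

Lemma measurable_family_blocks (lambda : S -> Prob R X) p :
  measurable_family lambda -> measurable_family (fun s => prob_blocks (lambda s) p).
Proof.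
move=> ml; elim: p => [|q p IH] /=; first by move=> B mB; exact: measurable_cst.
apply: (@measurable_family_prod q.+1 _ (fun s => prob_diag q.+1 (lambda s))
  (fun s => prob_blocks (lambda s) p)) => //.
exact: measurable_family_push.
Qed.

(** Symmetry of [Phi] removes $S_k$, after which linearity leaves finitely many integrals against
    measurable families. *)
Lemma measurable_charge_integral_FNk N k (lambda : S ->
  Prob R X) (Phi : pow X k -> R) :
  bounded_mfun (Phi : borel (pow X k) -> R) -> symmetric_fun Phi ->
  measurable_family lambda ->
  measurable_fun setT (fun s => charge_integral (FNk N k (lambda s)) Phi).
Proof.
move=> bPhi sPhi ml; rewrite /FNk.
under eq_fun => s.
  rewrite charge_integral_scale// charge_integral_add// charge_integral_of//.
  rewrite charge_integral_sum//.
  over.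
apply: measurable_funeM; apply: emeasurable_funD.
  by apply: measurable_integral => //; exact: measurable_family_pow.
under eq_fun => s.
  under eq_bigr => j _ do rewrite charge_integral_scale// charge_integral_sym//
    /Pj charge_integral_sum//.
  over.
apply: emeasurable_sum => j; apply: measurable_funeM.
apply: emeasurable_sum => n.
under eq_fun => s do rewrite charge_integral_sum//.
apply: emeasurable_sum => p.
under eq_fun => s do rewrite charge_integral_scale// charge_integral_of//.
apply: measurable_funeM; apply: measurable_integral => //.
apply: measurable_family_cast; apply: measurable_family_prod.
  exact: measurable_family_blocks.
exact: measurable_family_pow.
Qed.

End measurable_family.

Section empirical.
Context (R : realType) (X : polishType R) (N : nat) (N_gt0 : (0 < N)%N).

Lemma empirical_uniform (lambda : Empirical R X N_gt0) :
  exists x : pow X N, uniform_on (\val lambda) ([seq x i | i <- enum 'I_N] :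
    seq (borel X)).
Proof.
have /set_mem[x xE] := valP lambda; exists x => A mA.
by rewrite [LHS]xE// size_map size_enum_ord big_map big_enum.
Qed.

Lemma continuous_test_val (phi : Cb R X) :
  continuous (fun lambda : Empirical R X N_gt0 => test (\val lambda) phi).
Proof.
move=> lambda.
apply: (@continuous_comp _ _ _ (fun l : Empirical R X N_gt0 =>
  \val l : Prob R X) (fun m => test m phi)).
  exact: (@initial_continuous _ _ (set_val : set_type (empirical N) -> Prob R X)).
apply: (@continuous_comp _ _ _ (@test R X : Prob R X ->
  _) (fun g : prod_topology (fun _ : Cb R X => R) => g phi)).
  exact: initial_continuous.
exact: (@proj_continuous {classic (Cb R X)} (fun=> R) phi).
Qed.

(** On an open set, the mass is a limit of integrals of continuous functions, which are narrowly
    continuous in [lambda]. Dynkin's theorem extends measurability to Borel sets. *)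
Lemma measurable_family_val :
  measurable_family (fun lambda : borel (Empirical R X N_gt0) =>
    \val lambda : Prob R X).
Proof.
move=> A mA; move: A mA.
apply: (@dynkin_induction _ (borel X) (@open X)) => //.
- exact: openI.
- under eq_fun do rewrite probability_setT.
  exact: measurable_cst.
- move=> A oA; have [phi [cphi phi01 phiA]] := open_approx oA.
  have bphi n : bounded_continuous (phi n).
    split; [exact: cphi|exists 1 => x].
    by have /andP[p0 p1] := phi01 n x; rewrite ger0_norm.
  apply: (emeasurable_fun_cvg (fun n (lambda : borel (Empirical R X N_gt0)) =>
    (\int[\val lambda]_x (phi n x)%:E)%E)).
    move=> n; apply: (eq_measurable_fun (fun lambda : borel (Empirical R X N_gt0) =>
       (test (\val lambda) (exist _ (phi n) (bphi n)))%:E)).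
      move=> lambda _; rewrite /test /Rintegral fineK//.
      apply: bounded_mfun_fin_num; first by rewrite ltey_eq fin_num_measure.
      exact: (bounded_continuous_mfun (bphi n)).
    apply/measurable_EFinP; apply: continuous_borel_measurable.
    exact: continuous_test_val.
  by move=> lambda _; exact: cvg_open_approx.
- move=> A mA IH; under eq_fun do rewrite probability_setC//.
  exact: emeasurable_funB.
- move=> F mF tF IH.
  apply: (emeasurable_fun_cvg (fun n (lambda : borel (Empirical R X N_gt0)) =>
    (\sum_(0 <= i < n) \val lambda (F i))%E)).
    by move=> n; exact: emeasurable_sum.
  by move=> lambda _; apply: measure_sigma_additive.
Qed.

End empirical.

(** * Symmetrised plans and laws of empirical measures *)

Section uniform_prob.
Context d (T : measurableType d) (R : realType) (s : seq T).

Let s' := if nilp s then [:: point] else s.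

Let invr_size_ge0 : 0 <= (size s')%:R^-1 :> R.
Proof. by rewrite invr_ge0. Qed.

(* The empty list, on which there is no uniform law, is replaced by a singleton. *)
Definition uniform_prob : set T -> \bar R :=
  mscale (NngNum invr_size_ge0)
    (msum (fun i => dirac (nth point s' i) : {measure set T -> \bar R}) (size s')).

HB.instance Definition _ := Measure.on uniform_prob.

Let uniform_probE A : uniform_prob A =
  ((size s')%:R^-1%:E * \sum_(y <- s') \d_y A)%E.
Proof. by rewrite /uniform_prob /mscale/= /msum (big_nth point) big_mkord. Qed.

Let uniform_prob_setT : uniform_prob setT = 1%E.
Proof.
rewrite uniform_probE; under eq_bigr do rewrite diracT.
rewrite sumEFin -EFinM big_const_seq count_predT iter_addr_0 mulVf//.
by rewrite pnatr_eq0 /s'; case: (s).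
Qed.

HB.instance Definition _ := Measure_isProbability.Build _ _ _ uniform_prob
  uniform_prob_setT.

Lemma uniform_prob_on : (0 < size s)%N -> uniform_on uniform_prob s.
Proof. by move=> s0 A mA; rewrite uniform_probE /s'; case: (s) s0. Qed.

End uniform_prob.

(* [gT] is an argument so that unification can find the probability structure. *)
Definition giry_probability d (T : measurableType d) (R : realType) (g : giry T R)
  (gT : g setT = 1%E) : set T -> \bar R := g.

Section giry_probability.
Context d (T : measurableType d) (R : realType) (g : giry T R) (gT : g setT = 1%E).

HB.instance Definition _ := Measure.copy (giry_probability gT) g.
HB.instance Definition _ := Measure_isProbability.Build _ _ _ (giry_probability
  gT) gT.

End giry_probability.

(** * Mixtures of probabilities along a measurable kernel *)

Section bind.
Context d d' (S : measurableType d) (T : measurableType d') (R : realType).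

Lemma giry_bindE (mu : giry S R) (K : S ->
  giry T R) (mK : measurable_fun setT K) (A : set T) :
  measurable A -> giry_bind mu mK A = (\int[mu]_s K s A)%E.
Proof.
move=> mA; rewrite /giry_bind/=.
transitivity (giry_int (giry_map mK mu) (giry_ev ^~ A)); first by [].
by rewrite giry_int_map//; exact: measurable_giry_ev.
Qed.

Lemma giry_bind_integral (mu : giry S R) (K : S ->
  giry T R) (mK : measurable_fun setT K)
    (f : T -> R) : bounded_mfun f ->
  (\int[giry_bind mu mK]_x (f x)%:E = \int[mu]_s \int[K s]_x (f x)%:E)%E.
Proof.
move=> bf; have [mf [M fM]] := bf.
have finM (m : giry T R) : (m setT < +oo)%E by rewrite ltey_eq fin_num_measure.
have mf' : measurable_fun setT (fun x => (f x)%:E) by exact/measurable_EFinP.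
have mp : measurable_fun setT (fun x => (f x)%:E)^\+%E by exact: measurable_funepos.
have mn : measurable_fun setT (fun x => (f x)%:E)^\-%E by exact: measurable_funeneg.
set g := giry_bind mu mK.
have ig : g.-integrable setT (EFin \o f) := bounded_mfun_integrable (finM g) bf.
have E (h : T -> \bar R) : measurable_fun setT h -> (forall x, 0 <= h x)%E ->
    (\int[g]_x h x = \int[mu]_s \int[K s]_x h x)%E.
  by move=> mh h0; exact: (giry_int_bind mu mK mh h0).
(* Integrability of the inner integrals allows the formula for positive and negative parts to be
   subtracted. *)
have key (h : T -> \bar R) : measurable_fun setT h -> (forall x, 0 <= h x)%E ->
    g.-integrable setT h -> mu.-integrable setT (fun s => \int[K s]_x h x)%E.
  move=> mh h0 /integrableP[_ hoo]; apply/integrableP; split.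
    apply: (@measurableT_comp _ _ _ _ _ _ (fun m : giry T R => giry_int m h)) => //.
    exact: measurable_giry_int.
  under eq_integral => s _ do rewrite gee0_abs ?integral_ge0//.
  rewrite -E//; apply: le_lt_trans hoo.
  by under [leRHS]eq_integral => x _ do rewrite gee0_abs//.
rewrite integralE E// E// -integralB//.
- by apply: eq_integral => s _; rewrite [RHS]integralE.
- by apply: key => //; exact: integrable_funepos.
- by apply: key => //; exact: integrable_funeneg.
Qed.

End bind.

Section permutations.
Context (R : realType) (X : polishType R).

(** For [k = N] the only increasing map is the identity. *)
Lemma cost_full N (Phi : pow X N -> R) (x : pow X N) : (0 < N)%N ->
  symmetric_fun Phi ->
  cost Phi x = Phi x.
Proof.
move=> N0 sPhi; rewrite /cost binn invr1 mul1r.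
rewrite (sum_increasing (Ordinal N0) (fun s => Phi (Defs.reindex s x))).
rewrite (big_pred1 [set: 'I_N]%SET); last first.
  move=> A /=; apply/eqP/eqP => [AN|->]; last by rewrite cardsT card_ord.
  by apply/eqP; rewrite eqEcard finset.subsetT cardsT card_ord AN leqnn.
congr Phi; apply/funext => i; rewrite /Defs.reindex ffunE.
by rewrite enum_setT -enumT nth_ord_enum.
Qed.

(** The composite is the reindexing by [s * t], hence a right translation of the group; in the
    opposite order, below, it is a left translation. *)
Lemma sum_reindexS (V : nmodType) N (G : pow X N -> V) (t : 'S_N) (x : pow X N) :
  \sum_(s : 'S_N) G (Defs.reindex s (Defs.reindex t x)) =
  \sum_(s : 'S_N) G (Defs.reindex s x).
Proof.
rewrite [RHS](reindex_inj (mulIg t))/=; apply: eq_bigr => s _; congr G.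
by apply/funext => i; rewrite /Defs.reindex permM.
Qed.

Lemma sum_reindexS_post (V : nmodType) N (G : pow X N ->
  V) (t : 'S_N) (x : pow X N) :
  \sum_(s : 'S_N) G (Defs.reindex t (Defs.reindex s x)) =
  \sum_(s : 'S_N) G (Defs.reindex s x).
Proof.
rewrite [RHS](reindex_inj (mulgI t))/=; apply: eq_bigr => s _; congr G.
by apply/funext => i; rewrite /Defs.reindex permM.
Qed.

Lemma measurable_reindex (N : nat) (s : 'S_N) (A : set (borel (pow X N))) :
  measurable A ->
  measurable (@Defs.reindex X N N s @^-1` A : set (borel (pow X N))).
Proof.
move=> mA; rewrite -[X in measurable X]setTI.
exact: (continuous_borel (@continuous_reindex X N N s)).
Qed.

(** Rearrangements are repeated when coordinates of [x] coincide, so that the uniform law on this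
    list is $S_N \delta_x$. *)
Definition perms N (x : pow X N) : seq (pow X N) :=
  [seq Defs.reindex (s : 'S_N) x | s <- enum {: 'S_N}].

Lemma size_perms N (x : pow X N) : size (perms x) = N`!.
Proof. by rewrite size_map -cardE card_Sn. Qed.

Lemma big_perms (V : nmodType) N (x : pow X N) (G : pow X N -> V) :
  \sum_(y <- perms x) G y = \sum_(s : 'S_N) G (Defs.reindex s x).
Proof. by rewrite big_map big_enum. Qed.

Definition prob_perms N (x : pow X N) : Prob R (pow X N) :=
  uniform_prob R (perms x : seq (borel (pow X N))).

Lemma prob_perms_on N (x : pow X N) :
  uniform_on (prob_perms x) (perms x : seq (borel (pow X N))).
Proof. by apply: uniform_prob_on; rewrite size_perms fact_gt0. Qed.

Lemma prob_perms_reindex N (x : pow X N) (t : 'S_N) (A : set (borel (pow X N))) :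
  measurable A -> prob_perms x (@Defs.reindex X N N t @^-1` A) = prob_perms x A.
Proof.
move=> mA; rewrite [LHS]prob_perms_on ?[RHS]prob_perms_on//;
  last exact: measurable_reindex.
rewrite !big_perms; congr (_ * _)%E.
exact: (sum_reindexS_post (fun y => \d_(y : borel (pow X N)) A) t x).
Qed.

End permutations.

Section charge_sym.
Context (R : realType) (X : polishType R) (N : nat).

Lemma charge_bigE d (T : measurableType d) (I : Type) (s : seq I) (P : pred I)
    (nu : I -> {charge set T -> \bar R}) (A : set T) :
  (\big[@charge_add _ _ _/charge_zero]_(i <- s | P i) nu i) A =
    (\sum_(i <- s | P i) nu i A)%E.
Proof. by elim/big_rec2: _ => // i x y _ <-. Qed.

Lemma charge_symE (nu : {charge set (borel (pow X N)) -> \bar R}) A :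
  charge_sym nu A = ((N`!%:R)^-1%:E * \sum_(s :
    'S_N) nu (@Defs.reindex X N N s @^-1` A))%E.
Proof. by rewrite /charge_sym /charge_scale/= /cscale charge_bigE. Qed.

Lemma Prob_sym_reindex (gamma : Prob R (pow X N)) (t : 'S_N) (A :
  set (borel (pow X N))) :
  Prob_sym gamma -> measurable A ->
  gamma (@Defs.reindex X N N t @^-1` A) = gamma A.
Proof.
move=> sg mA; rewrite -[RHS]sg// -[LHS]sg; last exact: measurable_reindex.
rewrite !charge_symE; congr (_ * _)%E; rewrite [RHS](reindex_inj (mulgI t))/=.
apply: eq_bigr => s _; congr (gamma _); apply/seteqP.
by split => x /=; congr (A _); apply/funext => i; rewrite /Defs.reindex permM.
Qed.

(** The transposition of [i] and [j] preserves [gamma] and exchanges the two coordinates. *)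
Lemma Prob_sym_marginal (gamma : Prob R (pow X N)) (i j : 'I_N) (A :
  set (borel X)) :
  Prob_sym gamma -> measurable A -> marginal i gamma A = marginal j gamma A.
Proof.
move=> sg mA.
have mB : measurable ((fun x : pow X N => x j) @^-1` A : set (borel (pow X N))).
  by rewrite -[X in measurable X]setTI;
    exact: (continuous_borel (@continuous_coord X N j)).
rewrite [RHS](_ : _ = gamma ((fun x : pow X N => x j) @^-1` A))//.
rewrite -(Prob_sym_reindex (tperm i j) sg mB).
congr (gamma _); apply/seteqP.
by split => x /=; rewrite /Defs.reindex tpermR.
Qed.

Lemma prob_sym_reindex (gamma : Prob R (pow X N)) :
  (forall (t : 'S_N) (A : set (borel (pow X N))), measurable A ->
    gamma (@Defs.reindex X N N t @^-1` A) = gamma A) -> Prob_sym gamma.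
Proof.
move=> h A mA; rewrite charge_symE.
rewrite (eq_bigr (fun=> gamma A)); last by move=> s _; exact: h.
rewrite -[gamma A]fineK ?fin_num_measure// sumEFin -EFinM sumr_const card_Sn.
by rewrite -[X in _ * X]mulr_natl mulrA mulVf ?mul1r// pnatr_eq0 -lt0n fact_gt0.
Qed.

Lemma push_integral (S T : ptopologicalType) (f : S -> T) (cf : continuous f)
    (mu : Prob R S) (h : T -> R) : bounded_mfun (h : borel T -> R) ->
  (\int[push cf mu]_y (h y)%:E = \int[mu]_x (h (f x))%:E)%E.
Proof.
move=> bh; have mf := continuous_borel cf.
have bhf : bounded_mfun (h \o f : borel S -> R).
  split; first exact: (measurableT_comp bh.1 mf).
  by have [M hM] := bh.2; exists M => x; exact: hM.
have mh : measurable_fun [set: borel T] (fun x => (h x)%:E)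
  by apply/measurable_EFinP; exact: bh.1.
have muoo : (mu setT < +oo)%E by rewrite ltey_eq fin_num_measure.
exact: (integral_pushforward mf mh (bounded_mfun_integrable muoo bhf) measurableT).
Qed.

End charge_sym.

Lemma continuous_prod_topology (S : topologicalType) (I : Type) (T : I ->
  topologicalType)
    (f : S -> prod_topology T) :
  (forall i, continuous (fun s => f s i)) -> continuous f.
Proof.
move=> cf x; apply/cvg_sup => i A [B [[U oU <-] xU UB]].
have fxU : nbhs x ((fun s => f s i) @^-1` U).
  by apply: (cf i x); exact: open_nbhs_nbhs.
by apply: filterS fxU => y /= yU; exact: UB.
Qed.

Lemma continuous_average (R : realType) (X : ptopologicalType) N (phi : X ->
  R) : continuous phi ->
  continuous (fun y : pow X N => N%:R^-1 * \sum_(i < N) phi (y i) : R).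
Proof.
move=> cphi y.
have c i : {for y, continuous (fun y : pow X N => phi (y i))}.
  by apply: (@continuous_comp _ _ _ (fun z : pow X N => z i) phi);
    [exact: continuous_coord|exact: cphi].
have cs : {for y, continuous (fun y : pow X N => \sum_(i < N) phi (y i) : R)}.
  apply: cvg_big => //.
  by move=> a b; apply: add_continuous.
  by move=> i _; exact: c.
apply: (@continuousM _ _ (fun=> N%:R^-1)) => //.
exact: cst_continuous.
Qed.

Section empirical_law.
Context (R : realType) (X : polishType R) (N : nat) (N_gt0 : (0 < N)%N).

Definition empirical_prob (x : pow X N) : Prob R X :=
  uniform_prob R ([seq x i | i <- enum 'I_N] : seq (borel X)).

Lemma empirical_prob_on (x : pow X N) :
  uniform_on (empirical_prob x) ([seq x i | i <- enum 'I_N] : seq (borel X)).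
Proof. by apply: uniform_prob_on; rewrite size_map size_enum_ord. Qed.

Lemma empirical_prob_in (x : pow X N) : empirical_prob x \in empirical N.
Proof.
apply/mem_set; exists x => A mA.
by rewrite empirical_prob_on// size_map size_enum_ord big_map big_enum.
Qed.

Definition empirical_law (x : pow X N) : Empirical R X N_gt0 :=
  exist _ (empirical_prob x) (empirical_prob_in x).

(** The topology of the target is initial for the test functionals, and testing with [phi] gives the
    continuous function $\frac1N \sum_i \varphi(y_i)$. *)
Lemma continuous_empirical_law : continuous empirical_law.
Proof.
apply: (@continuous_comp_initial _ _ _ (set_val : set_type (empirical N) ->
  Prob R X)).
apply: (@continuous_comp_initial _ _ _ (@test R X)).
apply: (@continuous_prod_topology _ _ (fun _ : Cb R X => R)) => phi.
have [cphi _] := svalP phi.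
rewrite (_ : (fun _ => _) = fun y : pow X N =>
  N%:R^-1 * \sum_(i < N) sval phi (y i)).
  exact: continuous_average.
apply/funext => y; rewrite /= /test /Rintegral.
rewrite (uniform_on_integral (empirical_prob_on y)).
  by rewrite size_map size_enum_ord big_map big_enum.
exact: bounded_continuous_mfun (svalP phi).
Qed.

End empirical_law.

Lemma uniform_on_perm d (T : measurableType d) (R : realType) (mu : set T -> \bar R)
    (s t : seq T) : perm_eq s t -> uniform_on mu s -> uniform_on mu t.
Proof. by move=> st mus A mA; rewrite mus// (perm_size st) (perm_big _ st). Qed.

(** Sum $g(s(i))$ over all [s] and [i]. For fixed [i], translation shows that the sum over [s] does
    not depend on [i]; for fixed [s], the sum over [i] is that of [g]. *)
Lemma sum_perm_at (F : numFieldType) N (g : 'I_N -> F) (i0 : 'I_N) :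
  N`!%:R^-1 * \sum_(s : 'S_N) g (s i0) = N%:R^-1 * \sum_(i < N) g i.
Proof.
have E : N%:R * \sum_(s : 'S_N) g (s i0) = N`!%:R * \sum_(i < N) g i.
  transitivity (\sum_(i < N) \sum_(s : 'S_N) g (s i)).
    rewrite [RHS](eq_bigr (fun=> \sum_(s : 'S_N) g (s i0))).
      by rewrite sumr_const card_ord mulr_natl.
    move=> i _; rewrite [RHS](reindex_inj (mulgI (tperm i0 i)))/=.
    by apply: eq_bigr => s _; rewrite permM tpermL.
  rewrite exchange_big/= [LHS](eq_bigr (fun=> \sum_(i < N) g i)).
    by rewrite sumr_const card_Sn mulr_natl.
  by move=> s _; rewrite [RHS](reindex_inj (@perm_inj _ s)).
have N0 : N%:R != 0 :> F by rewrite pnatr_eq0 -lt0n (leq_ltn_trans _ (ltn_ord i0)).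
have F0 : N`!%:R != 0 :> F by rewrite pnatr_eq0 -lt0n fact_gt0.
by apply: (mulfI N0); rewrite mulrCA E !mulrA mulVf// divff.
Qed.

(** * Passage between symmetric plans and laws on empirical measures *)

Section main.
Context (R : realType) (X : polishType R) (N k : nat).
Context (N_gt0 : (0 < N)%N) (hk : (2 <= k)%N) (hkN : (k <= N)%N).
Context (Phi : pow X k -> R) (cPhi : bounded_continuous Phi) (sPhi :
  symmetric_fun Phi).

Let bPhi : bounded_mfun (Phi : borel (pow X k) ->
  R) := bounded_continuous_mfun cPhi.

Lemma bounded_cost : bounded_mfun (cost Phi : borel (pow X N) -> R).
Proof.
split.
  apply: measurable_funM; first exact: measurable_cst.
  under eq_fun do rewrite -big_filter.
  apply: measurable_sum => s.
  apply: (measurableT_comp bPhi.1).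
  exact: continuous_borel (@continuous_reindex X k N s).
have [B hB] := cPhi.2.
exists (`|('C(N, k)%:R)^-1| * \sum_(s : {ffun 'I_k -> 'I_N} | increasing s) B) => x.
rewrite normrM ler_wpM2l// (le_trans (ler_norm_sum _ _ _))//.
by apply: ler_sum => s _; exact: hB.
Qed.

(** By [charge_integral_FNk] the cost is a function of the empirical measure, which ignores the
    order of the points. *)
Lemma cost_reindexS (t : 'S_N) (x : pow X N) : cost Phi (Defs.reindex t x) =
  cost Phi x.
Proof.
have lx := empirical_prob_on N_gt0 x.
have ltx : uniform_on (empirical_prob x)
    ([seq Defs.reindex t x i | i <- enum 'I_N] : seq (borel X)).
  apply: uniform_on_perm lx.
  rewrite perm_sym (_ : [seq _ | i <- _] =
    [seq x i | i <- [seq t i | i <- enum 'I_N]]).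
    apply: perm_map; apply: uniq_perm;
      rewrite ?(map_inj_uniq (@perm_inj _ t)) ?enum_uniq//.
    move=> i; rewrite mem_enum; apply/mapP; exists (t^-1%g i); rewrite ?mem_enum//.
    by rewrite permKV.
  exact: (map_comp x t).
apply: EFin_inj; rewrite -(charge_integral_FNk hk hkN bPhi sPhi lx).
by rewrite -(charge_integral_FNk hk hkN bPhi sPhi ltx).
Qed.

Lemma sym_to_empirical (gamma : Prob R (pow X N)) (rho : Prob R X) :
  Prob_sym gamma ->
  (forall A : set (borel X), measurable A ->
    marginal (Ordinal N_gt0) gamma A = rho A) ->
  exists2 alpha : Prob R (Empirical R X N_gt0), barycenter alpha rho &
    (\int[alpha]_lambda charge_integral (FNk N k (\val lambda)) Phi =
     \int[gamma]_x (cost Phi x)%:E)%E.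
Proof.
move=> sg mrho.
exists (push (@continuous_empirical_law R X N N_gt0) gamma); last first.
  pose G (lambda : borel (Empirical R X N_gt0)) :
    R := fine (charge_integral (FNk N k (\val lambda)) Phi).
  have GE lambda : charge_integral (FNk N k (\val lambda)) Phi = (G lambda)%:E.
    by rewrite /G fineK// charge_integral_fin_num.
  have bG : bounded_mfun G.
    split.
      apply/measurable_EFinP.
      apply: (eq_measurable_fun (fun lambda : borel (Empirical R X N_gt0) =>
        charge_integral (FNk N k (\val lambda)) Phi)).
        by move=> lambda _; rewrite GE.
      by apply: measurable_charge_integral_FNk => //; exact: measurable_family_val.
    (* At each empirical measure [G] is the cost of an underlying configuration, hence inherits its
       bound. *)
    have [B hB] := bounded_cost.2; exists B => lambda.
    have [x xl] := @empirical_uniform R X N N_gt0 lambda.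
    by rewrite /G (charge_integral_FNk hk hkN bPhi sPhi xl)/= hB.
  under eq_integral do rewrite GE.
  rewrite (push_integral _ _ bG); apply: eq_integral => x _; rewrite -GE.
  by rewrite (charge_integral_FNk hk hkN bPhi sPhi (empirical_prob_on N_gt0 x)).
move=> phi bphi.
have bphi' := bounded_continuous_mfun bphi.
pose H (lambda : borel (Empirical R X N_gt0)) :
  R := fine (\int[\val lambda]_x (phi x)%:E)%E.
have HE (lambda : Empirical R X N_gt0) : (\int[\val lambda]_x (phi x)%:E)%E =
  (H lambda)%:E.
  by rewrite /H fineK// bounded_mfun_fin_num// ltey_eq fin_num_measure.
have bH : bounded_mfun H.
  split.
    apply/measurable_EFinP.
    apply: (eq_measurable_fun (fun lambda : borel (Empirical R X N_gt0) =>
      (\int[\val lambda]_x (phi x)%:E)%E)).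
      by move=> lambda _; rewrite HE.
    by apply: measurable_integral => //; exact: measurable_family_val.
  have [B hB] := bphi.2; exists B => lambda.
  have [x xl] := @empirical_uniform R X N N_gt0 lambda.
  rewrite /H (uniform_on_integral xl bphi')/= size_map size_enum_ord big_map
    big_enum/=.
  rewrite normrM normfV normr_nat ler_pdivrMl ?ltr0n// (le_trans (ler_norm_sum _
    _ _))//.
  by rewrite (le_trans (ler_sum _ (fun i _ =>
    hB (x i))))// sumr_const card_ord mulr_natl.
under eq_integral do rewrite HE.
rewrite (push_integral _ _ bH).
have bc i : bounded_mfun ((fun x : pow X N => phi (x i)) : borel (pow X N) -> R).
  apply: bounded_continuous_mfun; split; last by have [B hB] := bphi.2; exists B.
  by move=> x; apply: (@continuous_comp _ _ _ (fun z : pow X N => z i) phi);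
    [exact: continuous_coord|exact: bphi.1].
have gooo : (gamma setT < +oo)%E by rewrite ltey_eq fin_num_measure.
have ic i : gamma.-integrable setT (fun x : pow X N => (phi (x i))%:E).
  exact: bounded_mfun_integrable gooo (bc i).
transitivity (\int[gamma]_x (N%:R^-1%:E * \sum_(i < N) (phi (x i))%:E))%E.
  apply: eq_integral => x _; rewrite -HE (uniform_on_integral (empirical_prob_on
    N_gt0 x) bphi').
  by rewrite size_map size_enum_ord big_map big_enum/= sumEFin.
rewrite integralZl//; last by apply: integrable_sum => //= i _; exact: ic.
rewrite integral_sum//.
(* By symmetry every marginal of [gamma] equals the first one, that is [rho]. *)
have E i : (\int[gamma]_x (phi (x i))%:E = \int[rho]_x (phi x)%:E)%E.
  rewrite -(push_integral (@continuous_coord X N i) gamma bphi').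
  apply: eq_measure_integral => A mA _.
  by apply: etrans (mrho A mA); exact: (Prob_sym_marginal i (Ordinal N_gt0) sg mA).
rewrite (eq_bigr _ (fun i _ => E i)).
have fr : (\int[rho]_x (phi x)%:E)%E \is a fin_num.
  by apply: bounded_mfun_fin_num => //; rewrite ltey_eq fin_num_measure.
rewrite -(fineK fr) sumEFin sumr_const card_ord -EFinM -[X in _ * X]mulr_natl mulrA.
by rewrite mulVf ?mul1r// pnatr_eq0 -lt0n.
Qed.

Lemma empirical_to_sym (alpha : Prob R (Empirical R X N_gt0)) (rho : Prob R X) :
  barycenter alpha rho ->
  exists2 gamma : Prob R (pow X N), Prob_sym gamma /\
    (forall A : set (borel X), measurable A ->
      marginal (Ordinal N_gt0) gamma A = rho A) &
    (\int[gamma]_x (cost Phi x)%:E =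
     \int[alpha]_lambda charge_integral (FNk N k (\val lambda)) Phi)%E.
Proof.
move=> balpha.
have /choice[xs xsP] := @empirical_uniform R X N N_gt0.
pose K (lambda : borel (Empirical R X N_gt0)) : giry (borel (pow X N)) R :=
  to_giry (prob_perms (xs lambda) : Prob R (pow X N)).
have KE lambda (A : set (borel (pow X N))) : measurable A ->
    K lambda A = (N`!%:R^-1%:E * \sum_(s :
      'S_N) (\1_A (Defs.reindex s (xs lambda)))%:E)%E.
  move=> mA; rewrite [LHS]prob_perms_on// size_perms big_perms; congr (_ * _)%E.
have N2 : (2 <= N)%N by exact: leq_trans hkN.
(* The configurations [xs] are merely chosen, with no measurability. The mass of a Borel set is
   nevertheless measurable, being expressed through [lambda] alone by $F_{N,N}$. *)
have mK : measurable_fun setT K.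
  apply: measurable_giry_codensity => // A mA.
  (* Symmetrising the indicator of [A] makes the formula for [k = N] applicable; the cost is then
     [PhiA] itself, by [cost_full]. *)
  pose PhiA (x : pow X N) : R := \sum_(s : 'S_N) \1_A (Defs.reindex s x).
  have sPhiA : symmetric_fun PhiA.
    by move=> t x; exact: (sum_reindexS (\1_A : pow X N -> R)).
  have bPhiA : bounded_mfun (PhiA : borel (pow X N) -> R).
    split.
      apply: measurable_sum => s.
      apply: (@measurableT_comp _ _ _ _ _ _ (\1_A : borel (pow X N) -> R)).
        exact: measurable_indic.
      exact: continuous_borel (@continuous_reindex X N N s).
    exists (\sum_(s : 'S_N) 1) => x; rewrite (le_trans (ler_norm_sum _ _ _))//.
    apply: ler_sum => s _; rewrite indicE.
    by case: (_ \in _); rewrite ?normr1 ?normr0.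
  rewrite (_ : (fun _ => _) = fun lambda : borel (Empirical R X N_gt0) =>
    (N`!%:R^-1%:E * charge_integral (FNk N N (\val lambda)) PhiA)%E); last first.
    apply/funext => lambda; rewrite KE// sumEFin.
    by rewrite (charge_integral_FNk N2 (leqnn N) bPhiA sPhiA (xsP lambda))
      cost_full.
  apply: measurable_funeM.
  by apply: measurable_charge_integral_FNk => //; exact: measurable_family_val.
pose g := giry_bind (to_giry alpha) mK.
have gT : g setT = 1%E.
  rewrite /g giry_bindE// (eq_integral (cst 1%E)); last first.
    by move=> lambda _; exact: probability_setT.
  by rewrite integral_cst// mul1e;
    exact: (@probability_setT _ _ _ (alpha :
    probability (borel (Empirical R X N_gt0)) R)).
pose gamma : Prob R (pow X N) := giry_probability gT.
have gE (f : pow X N -> R) : bounded_mfun (f : borel (pow X N) -> R) ->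
    (\int[gamma]_x (f x)%:E = \int[alpha]_lambda
      (N`!%:R^-1 * \sum_(s : 'S_N) f (Defs.reindex s (xs lambda)))%:E)%E.
  move=> bf; rewrite [LHS](giry_bind_integral (to_giry alpha) mK bf).
  apply: eq_integral => lambda _.
  by rewrite (uniform_on_integral (prob_perms_on (xs lambda)) bf) size_perms
    big_perms.
exists gamma; first split.
- apply: prob_sym_reindex => t A mA.
  rewrite /gamma /giry_probability [LHS]giry_bindE; last exact: measurable_reindex.
  rewrite [RHS]giry_bindE//; apply: eq_integral => lambda _.
  exact: prob_perms_reindex.
- apply: eq_prob_borel => phi bphi.
  have bphi' := bounded_continuous_mfun bphi.
  rewrite (push_integral (@continuous_coord X N (Ordinal N_gt0)) gamma bphi').
  rewrite gE; last first.
    apply: bounded_continuous_mfun; split; last by have [B hB] := bphi.2; exists B.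
    by move=> x; apply: (@continuous_comp _ _ _ (fun z : pow X N =>
      z (Ordinal N_gt0)) phi);
      [exact: continuous_coord|exact: bphi.1].
  rewrite -balpha//; apply: eq_integral => lambda _.
  rewrite (uniform_on_integral (xsP lambda) bphi') size_map size_enum_ord big_map
    big_enum/=.
  (* The first coordinate of a uniformly permuted configuration is distributed according to its
     empirical measure. *)
  by rewrite (sum_perm_at (fun i => phi (xs lambda i))).
- rewrite gE; last exact: bounded_cost.
  apply: eq_integral => lambda _.
  rewrite (charge_integral_FNk hk hkN bPhi sPhi (xsP lambda)).
  rewrite (eq_bigr (fun=> cost Phi (xs lambda))); last by move=> s _;
    exact: cost_reindexS.
  rewrite sumr_const card_Sn -[X in _ * X]mulr_natl mulrA mulVf ?mul1r//.
Qed.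

End main.

Theorem theorem8p1 (R : realType) (X : polishType R) (N k : nat)
    (hk : (2 <= k)%N) (hkN : (k <= N)%N) (Phi : pow X k -> R)
    (cPhi : bounded_continuous Phi) (sPhi : symmetric_fun Phi)
    (rho : Prob R X) :
  CNk (lt0N hk hkN) Phi rho =
  ereal_inf
    [set (\int[alpha]_lambda charge_integral (FNk N k (\val lambda)) Phi)%E
    | alpha in [set alpha : Prob R (Empirical R X (lt0N hk hkN)) |
                 barycenter alpha rho]].
Proof.
rewrite /CNk; congr ereal_inf; apply/seteqP;
  split => [_ [gamma [sg mg] <-]|_ [alpha ba <-]].
  by have [alpha ba <-] := sym_to_empirical hk hkN cPhi sPhi sg mg; exists alpha.
by have [gamma [sg mg] <-] := empirical_to_sym hk hkN cPhi sPhi ba; exists gamma.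
Qed.
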